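(* Let $n\in\mathbb{N}$, let $t_f\in(0,\infty]$, let $\mathcal{I}=[0,t_f)$, and let \[ \Phi:\mathcal{I}\to\mathrm{CPTP}(n),\qquad t\mapsto \Phi_t, \] be a dynamical curve which is analytic in $t$. Then there exist a finite-dimensional Hilbert space $E$ with $\dim E\leq n^2$, a unit vector $\omega\in E$, and a family of unitary operators \[ U_t:\mathbb{C}^n\otimes E\to\mathbb{C}^n\otimes E,\qquad t\in\mathcal{I}, \] such that \[ \Phi_t(\rho)=\mathrm{Tr}_E\left(U_t(\rho\otimes|\omega\rangle\langle\omega|)U_t^\dagger\right) \] for all $\rho\in\mathcal{B}(\mathbb{C}^n)$, and such that the map $t\mapsto U_t$ is analytic on $(0,t_f)$. In particular, every quantum dynamical semigroup $(\Phi_t)_{t\geq 0}$ on $\mathbb{C}^n$ admits such a dilation, with $t\mapsto U_t$ analytic for $t>0$.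
   Context: $\mathcal{B}(\mathbb{C}^n)$ denotes the space of linear operators on $\mathbb{C}^n$. $\mathrm{CPTP}(n)$ denotes the set of all completely positive, trace-preserving linear maps $\mathcal{B}(\mathbb{C}^n)\to\mathcal{B}(\mathbb{C}^n)$ (quantum channels). A dynamical curve on an interval $\mathcal{I}\subseteq\mathbb{R}$ is any map $\mathcal{I}\to\mathrm{CPTP}(n)$, $t\mapsto\Phi_t$. Regularity (continuity, analyticity) of operator- or map-valued functions of $t$ is understood entrywise with respect to any fixed basis (equivalently in any norm, since all spaces are finite-dimensional); analyticity means real-analyticity in $t$ on the given interval. $\mathrm{Tr}_E$ denotes the partial trace over $E$, and $U_t^\dagger$ the adjoint of $U_t$. A quantum dynamical semigroup is a dynamical curve $(\Phi_t)_{t\geq 0}$ with $\Phi_0=\mathrm{id}$, $\Phi_{t+s}=\Phi_t\circ\Phi_s$ for all $s,t\geq 0$, and $t\mapsto\Phi_t$ continuous. *)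

(* Defs.v *)
From HB Require Import structures.
From mathcomp Require Import all_boot all_order all_algebra.
From mathcomp Require Import all_classical all_reals all_analysis.
From mathcomp Require Import complex mxtens.
Set Implicit Arguments. Unset Strict Implicit. Unset Printing Implicit Defensive.
Import Order.TTheory GRing.Theory Num.Theory numFieldNormedType.Exports.
Local Open Scope ring_scope.
Local Open Scope classical_set_scope.

Section QDefs.
Variable R : realType.
Local Notation C := (R[i]).

Definition adjmx m n (A : 'M[C]_(m, n)) : 'M[C]_(n, m) := map_mx Num.conj A^T.

Definition psdmx N (A : 'M[C]_N) : Prop :=
  forall v : 'cV[C]_N, 0 <= (adjmx v *m A *m v) 0 0.

Definition unitarymx N (U : 'M[C]_N) : Prop :=
  U *m adjmx U = 1%:M /\ adjmx U *m U = 1%:M.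

Definition linmap n (Phi : 'M[C]_n -> 'M[C]_n) : Prop :=
  forall (a : C) (A B : 'M[C]_n), Phi (a *: A + B) = a *: Phi A + Phi B.

(* id_k (x) Phi acting on B(C^k (x) C^n) = 'M_(k*n); the index (a,i) of C^k (x) C^n
   is mxtens_index (a,i) (the convention of mxtens.tensmx) *)
Definition ampl k n (Phi : 'M[C]_n -> 'M[C]_n) (X : 'M[C]_(k * n)) : 'M[C]_(k * n) :=
  \matrix_(p, q)
    Phi (\matrix_(i, j) X (mxtens_index ((mxtens_unindex p).1, i))
                          (mxtens_index ((mxtens_unindex q).1, j)))
        (mxtens_unindex p).2 (mxtens_unindex q).2.

Definition completely_positive n (Phi : 'M[C]_n -> 'M[C]_n) : Prop :=
  forall k (X : 'M[C]_(k * n)), psdmx X -> psdmx (ampl Phi X).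

Definition trace_preserving n (Phi : 'M[C]_n -> 'M[C]_n) : Prop :=
  forall A : 'M[C]_n, \tr (Phi A) = \tr A.

Definition CPTP n (Phi : 'M[C]_n -> 'M[C]_n) : Prop :=
  [/\ linmap Phi, completely_positive Phi & trace_preserving Phi].

Definition ptrace2 n m (M : 'M[C]_(n * m)) : 'M[C]_n :=
  \matrix_(i, j) \sum_(e < m) M (mxtens_index (i, e)) (mxtens_index (j, e)).

Definition unit_vector m (w : 'cV[C]_m) : Prop := (adjmx w *m w) 0 0 = 1.

Definition ranalytic_on (D : set R) (f : R -> R) : Prop :=
  forall t0, D t0 -> exists r : R, 0 < r /\ exists a : nat -> R,
    forall t, D t -> `|t - t0| < r ->
      (fun N : nat => \sum_(k < N) a k * (t - t0) ^+ k) @ \oo --> f t.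

Definition canalytic_on (D : set R) (f : R -> C) : Prop :=
  ranalytic_on D (fun t => complex.Re (f t)) /\ ranalytic_on D (fun t => complex.Im (f t)).

Definition ccontinuous_on (D : set R) (f : R -> C) : Prop :=
  {within D, continuous (fun t => complex.Re (f t))} /\
  {within D, continuous (fun t => complex.Im (f t))}.

Definition mx_analytic_on p q (D : set R) (U : R -> 'M[C]_(p, q)) : Prop :=
  forall i j, canalytic_on D (fun t => U t i j).

Definition curve_analytic_on n (D : set R) (Phi : R -> 'M[C]_n -> 'M[C]_n) : Prop :=
  forall i j k l, canalytic_on D (fun t => Phi t (delta_mx i j) k l).

Definition curve_continuous_on n (D : set R) (Phi : R -> 'M[C]_n -> 'M[C]_n) : Prop :=
  forall i j k l, ccontinuous_on D (fun t => Phi t (delta_mx i j) k l).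

Definition QDS n (Phi : R -> 'M[C]_n -> 'M[C]_n) : Prop :=
  [/\ forall t, 0 <= t -> CPTP (Phi t),
      Phi 0 = id,
      forall s t, 0 <= s -> 0 <= t -> Phi (t + s) = Phi t \o Phi s &
      curve_continuous_on [set t | 0 <= t] Phi].

Definition analytic_dilation n (D A : set R) (Phi : R -> 'M[C]_n -> 'M[C]_n) : Prop :=
  exists m : nat, (m <= n ^ 2)%N /\
  exists (w : 'cV[C]_m) (U : R -> 'M[C]_(n * m)),
    [/\ unit_vector w,
        forall t, D t -> unitarymx (U t),
        forall t, D t -> forall rho : 'M[C]_n,
          Phi t rho = ptrace2 (U t *m (rho *t (w *m adjmx w)) *m adjmx (U t)) &
        mx_analytic_on A U].

End QDefs.

(* Main.v *)
(* A positive semidefinite matrix with real-analytic entries on an open interval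
   has an analytic factorization [A = K K^*]: this is Cholesky elimination, where
   the pivot column is divided by an analytic square root of the diagonal entry.
   A nonnegative analytic function has zeros of even order only, hence an
   analytic square root; and Cauchy-Schwarz [|A_ji|^2 <= A_ii A_jj] makes the
   quotients locally bounded, so that their singularities are removable. Applied
   to the Choi matrix this yields analytic Kraus operators, i.e. an analytic
   isometry; applied to the projection onto its cokernel it yields the remaining
   columns of the unitary. No regularity is asked at [t = 0], where the same
   argument is run on the constant curve.
   A quantum dynamical semigroup [S] is analytic since, with [F] a primitive of
   [S], [S t = (F (t + x) - F t) (F x - F 0)^-1] is differentiable and solves a
   linear equation [S' = S L]. *)

Require Import Defs.
From HB Require Import structures.
From mathcomp Require Import all_boot all_order all_algebra.
From mathcomp Require Import all_classical all_reals all_analysis.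
From mathcomp Require Import complex mxtens.
From mathcomp Require Import ring lra zify.
Set Implicit Arguments. Unset Strict Implicit. Unset Printing Implicit Defensive.
Import Order.TTheory GRing.Theory Num.Theory numFieldNormedType.Exports.
Local Open Scope ring_scope.
Local Open Scope classical_set_scope.

(** * Germs of analytic functions *)

(** The Choi matrix of a channel has size [n * n], so its factor [K] has [n * n] columns, one per
    Kraus operator; this is the dimension of the environment. Diagonalising the Choi matrix would
    call for analytic eigenvectors through eigenvalue crossings; elimination uses only scalar roots
    and quotients. The delicate point is a coherent choice of root: at a zero of order [p.*2] it
    behaves like [h ^+ p], so it changes sign there when [p] is odd, and these choices must fit
    together along the whole interval. Evenness of the order needs a two-sided neighbourhood: at the
    endpoint [t = 0] a pivot may behave like [t], whose root is not analytic there. Division by a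
    pivot makes sense only off its zeros, so what is obtained that way is proved there and extended
    by density; a pivot that vanishes identically is treated apart. Germs are handled through
    difference quotients: products, inverses and roots then become exact recursions between
    functions, and a single constant [K] controls both the radius and the growth. *)

Lemma course_of_values (T : Type) (x0 : T) (F : nat -> (nat -> T) -> T) :
  (forall N s s', (forall j, (j < N)%N -> s j = s' j) -> F N s = F N s') ->
  exists r : nat -> T, forall N, r N = F N r.
Proof.
move=> HF; pose s k := iter k (fun s N => F N s) (fun _ => x0).
have Hs N : forall k k', (N < k)%N -> (N < k')%N -> s k N = s k' N.
  elim/ltn_ind: N => N IH [//|k] [//|k'] hk hk' /=.
  by apply: HF => j jN; apply: IH => //; apply: (leq_trans jN).
exists (fun N => s N.+1 N) => N /=.
by apply: HF => j jN; exact: (Hs j N j.+1).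
Qed.

Section Germs.
Variable R : realType.
Implicit Types (f g u : R -> R) (K : R) (r : nat -> R -> R).

(* [r N] is the N-fold difference quotient of [f] at 0: the remainder of the
   Taylor expansion at order N divided by [h ^+ N]. *)
Definition taylor_chain f K r : Prop :=
  1 <= K /\ forall h, `|h| * K < 1 -> r 0%N h = f h /\
    forall N, r N h = r N 0 + h * r N.+1 h /\ `|r N h| <= K ^+ N.+1.

Definition analytic0 f : Prop := exists K r, taylor_chain f K r.

Definition near0 (P : R -> Prop) : Prop :=
  exists2 d : R, 0 < d & forall h, `|h| < d -> P h.

Lemma near0W (P Q : R -> Prop) : (forall h, P h -> Q h) -> near0 P -> near0 Q.
Proof. by move=> PQ [d d0 H]; exists d => // h /H /PQ. Qed.

Lemma near0I (P Q : R -> Prop) :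
  near0 P -> near0 Q -> near0 (fun h => P h /\ Q h).
Proof.
move=> [d d0 HP] [e e0 HQ]; exists (Num.min d e) => [|h].
  by rewrite lt_min d0.
by rewrite lt_min => /andP[/HP ? /HQ].
Qed.

Lemma near0_lt (d : R) : 0 < d -> near0 (fun h => `|h| < d).
Proof. by exists d. Qed.

Lemma near0_chain K : 1 <= K -> near0 (fun h => `|h| * K < 1).
Proof.
move=> K1; have K0 : 0 < K by apply: lt_le_trans K1.
by exists K^-1 => [|h]; rewrite ?invr_gt0// -ltr_pdivlMr ?div1r.
Qed.

Lemma near0_self (P : R -> Prop) : near0 P -> P 0.
Proof. by move=> [d d0 H]; apply: H; rewrite normr0. Qed.

Lemma taylor_chainW f K K' r :
  K <= K' -> taylor_chain f K r -> taylor_chain f K' r.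
Proof.
move=> KK' [K1 H]; split=> [|h hK]; first exact: le_trans KK'.
have hK0 : `|h| * K < 1 by apply: le_lt_trans hK; rewrite ler_wpM2l.
have [-> Hr] := H _ hK0; split=> // N; have [e b] := Hr N; split=> //.
by apply: le_trans b _; rewrite lerXn2r ?nnegrE//; lra.
Qed.

Lemma analytic0_near f g :
  near0 (fun h => f h = g h) -> analytic0 f -> analytic0 g.
Proof.
move=> [d d0 H] [K [r Hr]]; exists (Num.max K d^-1), r.
have [K1 {}Hr] : taylor_chain f (Num.max K d^-1) r.
  by apply: taylor_chainW Hr; rewrite le_max lexx.
split=> // h hK; have [e1 e2] := Hr h hK; split=> //.
rewrite e1 H//; apply: contraTT hK; rewrite -!leNgt => dh.
rewrite -(divff (lt0r_neq0 d0)); apply: ler_pM => //.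
- exact: ltW.
- by rewrite invr_ge0 ltW.
- by rewrite le_max lexx orbT.
Qed.

Lemma analytic0_cst (c : R) : analytic0 (fun=> c).
Proof.
exists (1 + `|c|), (fun N _ => if N is 0 then c else 0).
have c0 := normr_ge0 c.
split=> [|h _]; first lra.
split=> // -[|N]; rewrite mulr0 addr0; split=> //; first by rewrite expr1; lra.
by rewrite normr0 exprn_ge0//; lra.
Qed.

Lemma analytic0_id : analytic0 id.
Proof.
exists 1, (fun N h => match N with 0 => h | 1 => 1 | _ => 0 end).
split=> // h; rewrite mulr1 => h1; split=> // -[|[|N]]; rewrite expr1n.
- by rewrite add0r mulr1 ltW.
- by rewrite mulr0 addr0 normr1.
- by rewrite mulr0 addr0 normr0.
Qed.

Lemma analytic0_common f g : analytic0 f -> analytic0 g ->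
  exists K rf rg, taylor_chain f K rf /\ taylor_chain g K rg.
Proof.
move=> [K [rf Hf]] [K' [rg Hg]]; exists (Num.max K K'), rf, rg.
by split; [apply: taylor_chainW Hf|apply: taylor_chainW Hg]; rewrite le_max lexx ?orbT.
Qed.

Lemma analytic0D f g : analytic0 f -> analytic0 g -> analytic0 (fun h => f h + g h).
Proof.
move=> af ag; have [K [rf [rg [[K1 Hf] [_ Hg]]]]] := analytic0_common af ag.
exists (2 * K), (fun N h => rf N h + rg N h); split=> [|h hK]; first lra.
have {}hK : `|h| * K < 1.
  by apply: le_lt_trans hK; rewrite ler_wpM2l//; lra.
have [ef {}Hf] := Hf h hK; have [eg {}Hg] := Hg h hK.
split=> [|N]; first by rewrite ef eg.
have [rfN bf] := Hf N; have [rgN bg] := Hg N; split.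
  by rewrite {1}rfN {1}rgN; ring.
apply: (le_trans (ler_normD _ _)); apply: (le_trans (lerD bf bg)).
rewrite exprMn -mulr2n -[leLHS]mulr_natl ler_wpM2r//; first by rewrite exprn_ge0//; lra.
by rewrite exprS ler_peMr// exprn_ege1//; lra.
Qed.

Lemma natr_le_exp2 (N : nat) : N.+1%:R <= 2 ^+ N :> R.
Proof.
elim: N => [|N IH]; first by rewrite expr0.
rewrite exprS [leRHS]mulr_natl mulr2n -natr1; apply: lerD => //.
by apply: (le_trans _ IH); rewrite ler1n.
Qed.

Lemma analytic0M f g : analytic0 f -> analytic0 g -> analytic0 (fun h => f h * g h).
Proof.
move=> af ag; have [K [rf [rg [[K1 Hf] [_ Hg]]]]] := analytic0_common af ag.
have K0 : 0 <= K by lra.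
(* Expand [f] to order [N], then expand [g] to order [N - j] in the term of degree [j]: what remains
   is [h ^+ N] times this function. It has [N + 1] terms, each at most [K ^+ N.+2], whence the
   constant [2 * K ^+ 2]. *)
exists (2 * K ^+ 2), (fun N h => rf N h * rg 0%N h +
  \sum_(j < N) rf j 0 * rg (N - j)%N h).
have KK : K <= 2 * K ^+ 2 by rewrite expr2; nra.
split=> [|h hK]; first by apply: le_trans KK.
have {}hK : `|h| * K < 1 by apply: le_lt_trans hK; rewrite ler_wpM2l.
have h0K : `|0 : R| * K < 1 by rewrite normr0 mul0r.
have [_ {}Hf0] := Hf 0 h0K.
have [ef {}Hf] := Hf h hK; have [eg {}Hg] := Hg h hK.
split=> [|N]; first by rewrite big_ord0 addr0 ef eg.
split.
  rewrite big_ord_recr /= subSnn.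
  have -> : \sum_(i < N) rf i 0 * rg (N.+1 - i)%N h =
            \sum_(i < N) rf i 0 * rg (N - i).+1%N h.
    by apply: eq_bigr => i _; rewrite subSn// ltnW.
  have -> : \sum_(j < N) rf j 0 * rg (N - j)%N h =
     \sum_(j < N) rf j 0 * rg (N - j)%N 0 +
     h * \sum_(j < N) rf j 0 * rg (N - j).+1%N h.
    rewrite mulr_sumr -big_split /=; apply: eq_bigr => j _.
    by rewrite (Hg _).1; ring.
  rewrite {1}(Hf N).1 {1}(Hg 0%N).1.
  rewrite [in RHS](Hg 0%N).1; ring.
have bnd (j k : nat) : `|rf j 0| * `|rg k h| <= K ^+ (j + k).+2.
  by rewrite -addSn -addnS exprD ler_pM// ?(Hf0 j).2 ?(Hg k).2.
apply: (le_trans (ler_normD _ _)).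
apply: (@le_trans _ _ (K ^+ N.+2 + \sum_(j < N) K ^+ N.+2)).
  apply: lerD.
    rewrite normrM [K ^+ _]exprSr ler_pM// ?(Hf N).2//.
    by have := (Hg 0%N).2; rewrite expr1.
  apply: (le_trans (ler_norm_sum _ _ _)); apply: ler_sum => j _.
  by rewrite normrM; apply: le_trans (bnd _ _) _; rewrite subnKC// ltnW.
rewrite sumr_const card_ord -[X in X + _]mulr1n -mulrnDr add1n -[leLHS]mulr_natl.
rewrite exprMn -exprM; apply: ler_pM => //; rewrite ?exprn_ge0//.
  by apply: (le_trans (natr_le_exp2 _)); rewrite ler_weXn2l//; lra.
by rewrite ler_weXn2l//; lia.
Qed.

Lemma analytic0X f p : analytic0 f -> analytic0 (fun h => f h ^+ p).
Proof.
move=> af; elim: p => [|p IH].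
  by under eq_fun do rewrite expr0; exact: analytic0_cst.
by under eq_fun do rewrite exprS; exact: analytic0M.
Qed.

Lemma analytic0N f : analytic0 f -> analytic0 (fun h => - f h).
Proof.
move=> af; under eq_fun do rewrite -mulN1r.
by apply: analytic0M => //; exact: analytic0_cst.
Qed.

Lemma analytic0_lipschitz f : analytic0 f ->
  exists2 L, 0 <= L & near0 (fun h => `|f h - f 0| <= L * `|h|).
Proof.
move=> [K [r [K1 H]]]; exists (K ^+ 2); first by rewrite exprn_ge0//; lra.
apply: near0W (near0_chain K1) => h hK.
have [e0 _] : r 0%N 0 = f 0 /\ True.
  by have [|-> _] := H 0; rewrite ?normr0 ?mul0r.
have [<- Hr] := H h hK; have [e _] := Hr 0%N; have [_ b] := Hr 1%N.
by rewrite -e0 e addrC addKr normrM mulrC ler_wpM2r.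
Qed.

Lemma analytic0_near_ball f (e : R) : analytic0 f -> 0 < e ->
  near0 (fun h => `|f h - f 0| < e).
Proof.
move=> /analytic0_lipschitz[L L0 Hf] e0.
have d0 : 0 < e / (L + 1) by rewrite divr_gt0//; lra.
apply: near0W (near0I Hf (near0_lt d0)) => h [hL].
rewrite ltr_pdivlMr; last lra.
move=> h1; apply: le_lt_trans hL _; have := normr_ge0 h; lra.
Qed.

Lemma analytic0_gt0 f : analytic0 f -> 0 < f 0 -> near0 (fun h => 0 < f h).
Proof.
move=> af f0; apply: near0W (analytic0_near_ball af f0) => h.
by rewrite ltr_norml => /andP[]; lra.
Qed.

Lemma analytic0_neq0 f : analytic0 f -> f 0 != 0 -> near0 (fun h => f h != 0).
Proof.
move=> af f0; have nf0 : 0 < `|f 0| by rewrite normr_gt0.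
apply: near0W (analytic0_near_ball af nf0) => h; apply: contraTneq => ->.
by rewrite sub0r normrN ltxx.
Qed.

Lemma analytic0_bounded f : analytic0 f ->
  exists2 M, 0 <= M & near0 (fun h => `|f h| <= M).
Proof.
move=> [K [r [K1 H]]]; exists K; first lra.
apply: near0W (near0_chain K1) => h /H[<- Hr]; have [_] := Hr 0%N.
by rewrite expr1.
Qed.

Lemma exp_small_eq0 (x q M : R) : 0 <= q < 1 -> (forall N, `|x| <= M * q ^+ N) -> x = 0.
Proof.
move=> /andP[q0 q1] H; apply/eqP; rewrite -normr_le0.
have cq : (fun N : nat => M * q ^+ N) @ \oo --> (M * 0 : R).
  apply: cvgM; first exact: cvg_cst.
  by apply: cvg_expr; rewrite ger0_norm.
rewrite -(mulr0 M) -(cvg_lim _ cq)//; apply: limr_ge; first by apply/cvg_ex; eexists; exact: cq.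
by near=> N; exact: H.
Unshelve. all: by end_near. Qed.

Lemma taylor_chain_expand f K r h (N : nat) : taylor_chain f K r -> `|h| * K < 1 ->
  f h = \sum_(k < N) r k 0 * h ^+ k + h ^+ N * r N h.
Proof.
move=> [K1 H] /H[<- Hr]; elim: N => [|N ->].
  by rewrite big_ord0 add0r expr0 mul1r.
by rewrite big_ord_recr /= {1}(Hr N).1 exprS; ring.
Qed.

Lemma analytic0_quotient f K r N : taylor_chain f K r -> analytic0 (r N).
Proof.
move=> [K1 H]; exists (K ^+ N.+1), (fun k h => r (k + N)%N h).
have KN : K <= K ^+ N.+1 by rewrite exprS ler_peMr ?exprn_ege1//; lra.
split=> [|h hK]; first by apply: le_trans KN.
have {hK}/H[_ Hr] : `|h| * K < 1 by apply: le_lt_trans hK; rewrite ler_wpM2l.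
split=> // k; have [e b] := Hr (k + N)%N; split=> //.
by apply: le_trans b _; rewrite -exprM ler_weXn2l//; lia.
Qed.

(** If all Taylor coefficients vanish, the remainder bound [K * (|h| * K) ^+ N] forces [f h = 0].
    Otherwise [p] is the first index with a nonzero coefficient, and [u] is the difference quotient
    of that order. *)
Lemma analytic0_order f : analytic0 f -> near0 (fun h => f h = 0) \/
  exists p u, [/\ analytic0 u, u 0 != 0 & near0 (fun h => f h = h ^+ p * u h)].
Proof.
move=> [K [r Hr]]; have [K1 _] := Hr; have [H|] := pselect (forall N, r N 0 = 0).
  left; apply: near0W (near0_chain K1) => h hK.
  apply: (@exp_small_eq0 _ (`|h| * K) K) => [|N]; first by rewrite mulr_ge0//; lra.
  rewrite (taylor_chain_expand N Hr hK) big1 ?add0r => [|k _]; last by rewrite H mul0r.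
  have [_ /(_ h hK)[_ /(_ N)[_ b]]] := Hr.
  by rewrite normrM normrX exprMn mulrCA -exprS ler_wpM2l.
move=> /existsNP[N0 /eqP HN0]; right.
have exN : exists N, r N 0 != 0 by exists N0.
case: (ex_minnP exN) => p rp Hp; exists p, (r p); split=> //.
  exact: analytic0_quotient Hr.
apply: near0W (near0_chain K1) => h hK.
rewrite (taylor_chain_expand p Hr hK) big1 ?add0r// => k _.
have [->|/Hp] := eqVneq (r k 0) 0; first by rewrite mul0r.
by rewrite leqNgt ltn_ord.
Qed.

(** Removable singularity: the growth bound forces the order of vanishing to be at least [p]. *)
Lemma analytic0_divX f p (M : R) : analytic0 f -> near0 (fun h => `|f h| <= M * `|h| ^+ p) ->
  exists2 w, analytic0 w & near0 (fun h => f h = h ^+ p * w h).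
Proof.
move=> af bf; have [Hf|[q [u [au u0 Hf]]]] := analytic0_order af.
  exists (fun=> 0); first exact: analytic0_cst.
  by apply: near0W Hf => h ->; rewrite mulr0.
have [pq|qp] := leqP p q.
  exists (fun h => h ^+ (q - p) * u h).
    by apply: analytic0M => //; apply: analytic0X; exact: analytic0_id.
  by apply: near0W Hf => h ->; rewrite mulrA -exprD subnKC.
(* An order [q < p] is refuted at one small [h > 0]: the bound gives [|u h| <= |M| * h < |u 0| / 2],
   while continuity keeps [|u h|] above [|u 0| / 2]. Asking also [h < 1] gives
   [h ^+ (p - q) <= h]. *)
have nu0 : 0 < `|u 0| by rewrite normr_gt0.
have eu0 : 0 < `|u 0| / 2 by rewrite divr_gt0.
have eM0 : 0 < `|u 0| / (2 * (`|M| + 1)).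
  by rewrite divr_gt0// mulr_gt0//; have := normr_ge0 M; lra.
have [d d0 H] := near0I (near0I Hf bf) (near0I (analytic0_near_ball au eu0)
  (near0I (near0_lt ltr01) (near0_lt eM0))).
have [] := H (d / 2); first by rewrite ger0_norm; lra.
set h := d / 2; have h0 : 0 < h by rewrite divr_gt0.
rewrite (gtr0_norm h0) => -[-> +] [+ [h1]].
rewrite ltr_pdivlMr; last by have := normr_ge0 M; lra.
rewrite normrM normrX (gtr0_norm h0) -(subnKC (ltnW qp)) exprD mulrCA.
rewrite ler_pM2l ?exprn_gt0// => le1 le2 le3.
have hpq : h ^+ (p - q) <= h.
  by rewrite -subn_gt0 in qp; case: (p - q)%N qp => // k _; rewrite exprS ger_pMr// exprn_ile1// ltW.
have Mh : M * h ^+ (p - q) <= `|M| * h.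
  apply: (@le_trans _ _ (`|M| * h ^+ (p - q))); last by rewrite ler_wpM2l.
  by rewrite ler_wpM2r ?ler_norm// exprn_ge0// ltW.
have uh : `|u 0| <= `|u h - u 0| + `|u h|.
  by rewrite distrC; apply: le_trans (ler_normD _ _); rewrite subrK.
move: le3; rewrite ltr_pdivlMr; last by have := normr_ge0 M; lra.
by move=> le3; exfalso; lra.
Qed.

(** Any disc and any geometric bound will do: the summands of [K] absorb the radius, the factor [B]
    and the ratio [tau]. *)
Lemma taylor_chain_intro f r (d B tau : R) : 0 < d ->
  (forall h, `|h| < d -> r 0%N h = f h) ->
  (forall N h, `|h| < d -> r N h = r N 0 + h * r N.+1 h) ->
  (forall N h, `|h| < d -> `|r N h| <= B * tau ^+ N) -> analytic0 f.
Proof.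
move=> d0 r0 rec bnd; pose K := 1 + d^-1 + `|B| + `|tau|.
have di : 0 < d^-1 by rewrite invr_gt0.
have B0 := normr_ge0 B; have t0 := normr_ge0 tau.
exists K, r; split=> [|h hK]; first by rewrite /K; lra.
have hd : `|h| < d.
  rewrite ltNge; apply: contraTN hK; rewrite -leNgt => dh.
  rewrite -(divff (lt0r_neq0 d0)); apply: ler_pM => //; rewrite ?ltW// /K; lra.
split=> [|N]; first exact: r0.
split; first exact: rec.
apply: le_trans (bnd _ _ hd) _; apply: le_trans (ler_norm _) _.
rewrite normrM normrX exprS; apply: ler_pM; rewrite ?exprn_ge0//; first by rewrite /K; lra.
by rewrite lerXn2r ?nnegrE// /K; lra.
Qed.

(** A convolution of two geometric sequences is of the size of the faster one once the ratios differ
    by a factor 2. This closes the majorant induction for the inverse. *)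
Lemma sum_geom_le (K tau : R) N : 0 <= K -> 2 * K <= tau ->
  \sum_(j < N.+1) K ^+ j * tau ^+ (N - j) <= 2 * tau ^+ N.
Proof.
move=> K0 Kt; have t0 : 0 <= tau by lra.
elim: N => [|N IH]; first by rewrite big_ord1 !expr0; lra.
rewrite big_ord_recl /= expr0 mul1r subn0.
have -> : \sum_(i < N.+1) K ^+ bump 0 i * tau ^+ (N.+1 - bump 0 i) =
   K * \sum_(i < N.+1) K ^+ i * tau ^+ (N - i).
  by rewrite mulr_sumr; apply: eq_bigr => i _; rewrite /bump add1n subSS exprS mulrA.
have tN : 0 <= tau ^+ N by rewrite exprn_ge0.
have h1 := ler_wpM2l K0 IH.
have h2 : K * (2 * tau ^+ N) <= tau * tau ^+ N.
  by rewrite mulrA [K * 2]mulrC ler_wpM2r.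
rewrite exprS; lra.
Qed.

Lemma analytic0V u : analytic0 u -> u 0 != 0 -> analytic0 (fun h => (u h)^-1).
Proof.
move=> au u0; have [K [ru Hu]] := au; have [K1 _] := Hu.
pose w h := (u h)^-1.
(* The order [N] remainder of the product [u * w = 1] is zero for [N > 0]. Solving the product
   formula for the remainder of [w], whose coefficient is [u 0], gives this recursion. *)
have [|r Hr] := @course_of_values (R -> R) (fun=> 0) (fun N s h =>
  if N is N'.+1 then - w 0 * (ru N h * w h + \sum_(j < N') ru j.+1 0 * s (N' - j)%N h)
  else w h).
  move=> [|N] s s' ss'; apply/funext => h//; congr (_ * (_ + _)).
  by apply: eq_bigr => j _; rewrite ss'// ltnS leq_subr.
have nu0 : 0 < `|u 0| by rewrite normr_gt0.
have eu0 : 0 < `|u 0| / 2 by rewrite divr_gt0.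
have [d d0 Hd] := near0I (near0_chain K1)
  (near0I (analytic0_neq0 au u0) (analytic0_near_ball au eu0)).
have Hrec N h : `|h| < d -> r N h = r N 0 + h * r N.+1 h.
  elim/ltn_ind: N => -[|N] IH hd; have [hK [uh _]] := Hd h hd.
    rewrite !Hr big_ord0 addr0.
    have := taylor_chain_expand 1 Hu hK; rewrite big_ord1 !expr0 mulr1 expr1.
    have [_ /(_ 0)[|-> _]] := Hu; first by rewrite normr0 mul0r.
    move=> e; rewrite /w.
    have {}e : h * ru 1%N h = u h - u 0 by rewrite e; ring.
    have -> : h * (- (u 0)^-1 * (ru 1%N h / u h)) = - (h * ru 1%N h) * (u 0)^-1 / u h.
      by ring.
    by rewrite e; field; rewrite uh.
  rewrite (Hr N.+1) (Hr N.+2) big_ord_recr /= subSnn.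
  have -> : \sum_(i < N) ru i.+1 0 * r (N.+1 - i)%N h =
            \sum_(i < N) ru i.+1 0 * r (N - i).+1%N h.
    by apply: eq_bigr => i _; rewrite subSn// ltnW.
  have -> : \sum_(j < N) ru j.+1 0 * r (N - j)%N h =
     \sum_(j < N) ru j.+1 0 * r (N - j)%N 0 +
     h * \sum_(j < N) ru j.+1 0 * r (N - j).+1%N h.
    rewrite mulr_sumr -big_split /=; apply: eq_bigr => j _.
    by rewrite (IH (N - j)%N) ?ltnS ?leq_subr//; ring.
  have [_ /(_ h hK)[_ /(_ N.+1)[-> _]]] := Hu.
  have e1 : w h = w 0 + h * r 1%N h.
    by have := IH 0%N isT hd; rewrite {1 2}Hr.
  set S1 := \sum_(j < N) _; set S2 := \sum_(j < N) _.
  have -> : (ru N.+1 0 + h * ru N.+2 h) * w h =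
     ru N.+1 0 * (w 0 + h * r 1%N h) + h * ru N.+2 h * w h.
    by rewrite -e1; ring.
  ring.
have w00 : 0 < `|w 0| by rewrite normr_gt0 invr_neq0.
have wb h : `|h| < d -> `|w h| <= 2 * `|w 0|.
  move=> /Hd[_ [uh]]; have := ler_dist_dist (u 0) (u h); rewrite distrC => a b.
  have {a b} c : `|u 0| / 2 <= `|u h|.
    by have := ler_norm (`|u 0| - `|u h|); lra.
  by rewrite !normfV -[2]invrK -invfM lef_pV2 ?posrE ?normr_gt0// mulrC.
(* [B] bounds [w] near 0. One step of the recursion multiplies the bound by at most
   [2 * K ^+ 2 * |w 0|], and the summand [2 * K] of [tau] is what the convolution estimate
   requires. *)
pose B : R := 2 * `|w 0|; pose tau : R := 2 * K + 2 * K ^+ 2 * `|w 0|.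
have K2 : 0 <= K ^+ 2 * `|w 0| by rewrite mulr_ge0// exprn_ge0//; lra.
have tK : 2 * K <= tau by rewrite /tau; lra.
have t0 : 0 <= tau by lra.
have B0 : 0 <= B by rewrite /B; lra.
have Hb N h : `|h| < d -> `|r N h| <= B * tau ^+ N.
  elim/ltn_ind: N h => -[|N] IH h hd; first by rewrite Hr expr0 mulr1 wb.
  rewrite Hr; have [hK _] := Hd h hd.
  have [_ /(_ h hK)[_ Hru]] := Hu.
  have [_ /(_ 0)[|_ Hru0]] := Hu; first by rewrite normr0 mul0r.
  rewrite normrM normrN.
  apply: (@le_trans _ _ (`|w 0| * (K ^+ 2 * B * \sum_(j < N.+1) K ^+ j * tau ^+ (N - j)))).
    apply: ler_wpM2l => //; rewrite big_ord_recr /= addrC mulrDr subnn expr0 mulr1.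
    apply: (le_trans (ler_normD _ _)); apply: lerD.
      rewrite normrM mulrAC -exprD; apply: ler_pM => //; last exact: wb.
      exact: (Hru N.+1).2.
    apply: (le_trans (ler_norm_sum _ _ _)); rewrite mulr_sumr; apply: ler_sum => j _.
    rewrite normrM.
    have -> : K ^+ 2 * B * (K ^+ j * tau ^+ (N - j)) = K ^+ j.+2 * (B * tau ^+ (N - j)).
      by rewrite -(addn2 j) exprD; ring.
    apply: ler_pM => //; first exact: (Hru0 j.+1).2.
    by apply: IH => //; rewrite ltnS leq_subr.
  have KB : 0 <= K ^+ 2 * B by rewrite mulr_ge0// exprn_ge0//; lra.
  apply: (@le_trans _ _ (`|w 0| * (K ^+ 2 * B * (2 * tau ^+ N)))).
    by do 2! apply: ler_wpM2l => //; apply: sum_geom_le => //; lra.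
  have -> : `|w 0| * (K ^+ 2 * B * (2 * tau ^+ N)) = B * tau ^+ N * (2 * K ^+ 2 * `|w 0|) by ring.
  have -> : B * tau ^+ N.+1 = B * tau ^+ N * tau by rewrite exprSr mulrA.
  by apply: ler_wpM2l; [rewrite mulr_ge0// exprn_ge0|rewrite /tau; lra].
by apply: taylor_chain_intro d0 _ Hrec Hb => h _; rewrite Hr.
Qed.

End Germs.

(** * Square root of a positive germ *)

Section Germs.
Variable R : realType.
Implicit Types (f g u : R -> R) (K : R) (r : nat -> R -> R).

(** The left side keeps only the index pairs of total degree below [N] of the square on the right,
    and all terms are nonnegative. *)
Lemma triangle_sum_le (y z : nat -> R) N :
  (forall j, 0 <= y j) -> (forall j, 0 <= z j) ->
  \sum_(n < N) \sum_(j < n.+1) y j * z (n - j)%N <= (\sum_(j < N) y j) * (\sum_(j < N) z j).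
Proof.
elim: N y => [|N IH] y y0 z0; first by rewrite !big_ord0 mul0r.
have -> : \sum_(n < N.+1) \sum_(j < n.+1) y j * z (n - j)%N =
   y 0%N * (\sum_(j < N.+1) z j) + \sum_(n < N) \sum_(j < n.+1) y j.+1 * z (n - j)%N.
  under eq_bigr do rewrite big_ord_recl.
  rewrite big_split /= mulr_sumr; congr (_ + _).
    by apply: eq_bigr => i _; rewrite subn0.
  by rewrite big_ord_recl big_ord0 add0r.
rewrite [\sum_(j < N.+1) y j]big_ord_recl mulrDl lerD2l.
apply: (le_trans (IH (fun j => y j.+1) _ z0)) => //.
apply: ler_wpM2l; first by apply: sumr_ge0.
by rewrite big_ord_recr /= lerDl.
Qed.

Lemma geometric_sum_le2 (q : R) N : 0 <= q -> 2 * q <= 1 -> \sum_(i < N) q ^+ i <= 2.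
Proof.
move=> q0 q1; have := sum_geom_le N q0 q1; rewrite expr1n mulr1.
under eq_bigr do rewrite expr1n mulr1.
rewrite big_ord_recr /=; have := exprn_ge0 N q0; lra.
Qed.

Lemma analytic0_sqrt u : analytic0 u -> 0 < u 0 -> analytic0 (fun h => Num.sqrt (u h)).
Proof.
move=> au u0; have [K [ru Hu]] := au; have [K1 _] := Hu.
pose v h : R := Num.sqrt (u h).
have v0 : 0 < v 0 by rewrite sqrtr_gt0.
have vge h : 0 <= v h by apply: sqrtr_ge0.
have vv0 h : v h + v 0 != 0 by rewrite gt_eqF// ltr_wpDl.
(* In the product formula for [v * v = u] the unknown remainder of order [N] occurs twice, with
   coefficients [v h] and [v 0]; the other terms involve lower orders only. *)
have [|r Hr] := @course_of_values (R -> R) (fun=> 0) (fun N s h =>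
  if N is N'.+1 then (ru N h - \sum_(j < N') s j.+1 0 * s (N' - j)%N h) / (v h + v 0)
  else v h).
  move=> [|N] s s' ss'; apply/funext => h//; congr ((_ - _) / _).
  by apply: eq_bigr => j _; rewrite !ss' ?ltnS ?leq_subr.
have [d d0 Hd] := near0I (near0_chain K1) (analytic0_gt0 au u0).
have Hr1 h : `|h| < d -> v h = v 0 + h * r 1%N h.
  move=> /Hd[hK uh]; rewrite Hr big_ord0 subr0.
  have := taylor_chain_expand 1 Hu hK; rewrite big_ord1 !expr0 mulr1 expr1.
  have [_ /(_ 0)[|-> _]] := Hu; first by rewrite normr0 mul0r.
  move=> e; rewrite mulrA.
  have -> : h * ru 1%N h = v h ^+ 2 - v 0 ^+ 2.
    by rewrite !sqr_sqrtr ?ltW// e; ring.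
  by rewrite subr_sqr mulfK//; ring.
have Hrec N h : `|h| < d -> r N h = r N 0 + h * r N.+1 h.
  elim/ltn_ind: N => -[|N] IH hd; have [hK uh] := Hd h hd.
    by rewrite {1 2}Hr Hr1.
  apply: (mulfI (vv0 h)).
  have E k (g : R) : r k.+1 g * (v g + v 0) = ru k.+1 g - \sum_(j < k) r j.+1 0 * r (k - j)%N g.
    by rewrite {1}Hr divfK.
  have := E N h; have := E N 0; have := E N.+1 h.
  rewrite big_ord_recr /= subSnn.
  have -> : \sum_(i < N) r i.+1 0 * r (N.+1 - i)%N h =
            \sum_(i < N) r i.+1 0 * r (N - i).+1%N h.
    by apply: eq_bigr => i _; rewrite subSn// ltnW.
  have -> : \sum_(j < N) r j.+1 0 * r (N - j)%N h =
     \sum_(j < N) r j.+1 0 * r (N - j)%N 0 +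
     h * \sum_(j < N) r j.+1 0 * r (N - j).+1%N h.
    rewrite mulr_sumr -big_split /=; apply: eq_bigr => j _.
    by rewrite (IH (N - j)%N) ?ltnS ?leq_subr//; ring.
  set S1 := \sum_(j < N) _; set S2 := \sum_(j < N) _ => e2 e0 e1.
  rewrite mulrDr mulrCA.
  rewrite ![(v h + v 0) * _]mulrC e1 e2.
  have [_ /(_ h hK)[_ /(_ N.+1)[-> _]]] := Hu.
  have -> : ru N.+1 0 = r N.+1 0 * (v 0 + v 0) + S2 by rewrite e0; ring.
  rewrite (Hr1 h hd); ring.
(* Majorant of the recursion: bounds replace the remainders, and [v 0] replaces the larger
   denominator [v h + v 0]. The recursion is quadratic, so a geometric bound does not follow by
   direct induction. *)
have [|b Hb] := @course_of_values R 0 (fun N s =>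
  if N is N'.+1 then (K ^+ N.+1 + \sum_(j < N') s j.+1 * s (N' - j)%N) / v 0
  else K).
  move=> [|N] s s' ss' //; congr ((_ + _) / _).
  by apply: eq_bigr => j _; rewrite !ss' ?ltnS ?leq_subr.
have vK h : `|h| < d -> v h <= K.
  move=> /Hd[hK uh]; have [_ /(_ h hK)[e /(_ 0%N)[_ ]]] := Hu.
  rewrite e expr1 => ub; rewrite -(@ler_pXn2r _ 2)// ?nnegrE//; try lra.
  have -> : v h ^+ 2 = u h by rewrite sqr_sqrtr// ltW.
  apply: (le_trans (ler_norm _)).
  by apply: le_trans ub _; rewrite expr2 ler_peMl//; lra.
have b0 N : 0 <= b N.
  elim/ltn_ind: N => -[|N] IH; rewrite Hb; first lra.
  apply: divr_ge0; last exact: ltW.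
  apply: addr_ge0; first by apply: exprn_ge0; lra.
  by apply: sumr_ge0 => j _; rewrite mulr_ge0 ?IH// ltnS ?leq_subr.
have rb N h : `|h| < d -> `|r N h| <= b N.
  elim/ltn_ind: N h => -[|N] IH h hd; have [hK uh] := Hd h hd.
    by rewrite Hr Hb ger0_norm// vK.
  rewrite Hr Hb normrM normfV (ger0_norm (addr_ge0 (vge h) (vge 0))).
  have v00 := ltW v0.
  apply: ler_pM => //; rewrite ?invr_ge0 ?addr_ge0//; last first.
    by rewrite lef_pV2 ?posrE ?lerDr// ltr_wpDl.
  apply: (le_trans (ler_normB _ _)); apply: lerD.
    by have [_ /(_ h hK)[_ /(_ N.+1)[_ ]]] := Hu.
  apply: (le_trans (ler_norm_sum _ _ _)); apply: ler_sum => j _.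
  by rewrite normrM ler_pM ?IH ?normr0 ?ltnS ?leq_subr.
(* the weights [b N.+1 * rho ^+ N.+1] have partial sums at most [v 0 / 2] *)
pose m : R := Num.min 1 (v 0 ^+ 2); pose rho : R := m / (8 * K ^+ 2).
have m1 : m <= 1 by rewrite /m ge_min lexx.
have mv : m <= v 0 ^+ 2 by rewrite /m ge_min lexx orbT.
have m0 : 0 < m by rewrite /m lt_min ltr01 exprn_gt0.
have K0 : 0 < K by lra.
have rho0 : 0 < rho by rewrite /rho divr_gt0// mulr_gt0// exprn_gt0.
have Krho : K ^+ 2 * rho = m / 8 by rewrite /rho; field; rewrite gt_eqF.
have Krho2 : K * rho <= 1 / 2.
  have : K * rho <= K ^+ 2 * rho by rewrite ler_pM2r// expr2; nra.
  by rewrite Krho; lra.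
clearbody rho; pose y n := b n.+1 * rho ^+ n.+1.
have y0 n : 0 <= y n by rewrite mulr_ge0// exprn_ge0// ltW.
have yE n : v 0 * y n = K * (K * rho) ^+ n.+1 + \sum_(j < n) y j * y (n.-1 - j)%N.
  rewrite /y Hb mulrA [v 0 * _]mulrC divfK ?gt_eqF// mulrDl; congr (_ + _).
    by rewrite exprMn mulrA -exprS.
  rewrite mulr_suml; apply: eq_bigr => j _.
  have -> : (n.-1 - j).+1 = (n - j)%N by have := ltn_ord j; lia.
  have -> : rho ^+ n.+1 = rho ^+ j.+1 * rho ^+ (n - j).
    by rewrite -exprD; congr (_ ^+ _); have := ltn_ord j; lia.
  ring.
have geo N : \sum_(n < N) K * (K * rho) ^+ n.+1 <= v 0 ^+ 2 / 4.
  rewrite -mulr_sumr.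
  have -> : \sum_(n < N) (K * rho) ^+ n.+1 = K * rho * \sum_(n < N) (K * rho) ^+ n.
    by rewrite mulr_sumr; apply: eq_bigr => n _; rewrite exprS.
  have Kr0 : 0 <= K * rho by rewrite mulr_ge0// ltW.
  have g2 : \sum_(n < N) (K * rho) ^+ n <= 2.
    by apply: geometric_sum_le2 => //; lra.
  rewrite mulrA mulrA -expr2 Krho.
  have := ler_wpM2l (ltW m0) g2; lra.
(* If [S] is the partial sum, the recursion gives [v 0 * S' <= v 0 ^+ 2 / 4 + S ^+ 2] for the next
   one [S'], and [v 0 / 2] is preserved by this inequality. The choice of [rho] is what makes the
   geometric term at most [v 0 ^+ 2 / 4]. *)
have SN N : \sum_(n < N) y n <= v 0 / 2.
  elim: N => [|N IH]; first by rewrite big_ord0 divr_ge0// ltW.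
  rewrite -(ler_pM2l v0) mulr_sumr.
  under eq_bigr do rewrite yE.
  rewrite big_split /=; have g := geo N.+1.
  have t : \sum_(i < N.+1) \sum_(j < i) y j * y (i.-1 - j)%N <= v 0 ^+ 2 / 4.
    rewrite big_ord_recl big_ord0 add0r /=.
    apply: (le_trans (triangle_sum_le N y0 y0)).
    have S0 : 0 <= \sum_(j < N) y j by apply: sumr_ge0.
    have -> : v 0 ^+ 2 / 4 = (v 0 / 2) * (v 0 / 2) by field.
    by apply: ler_pM.
  have -> : v 0 * (v 0 / 2) = v 0 ^+ 2 / 4 + v 0 ^+ 2 / 4 by field.
  exact: lerD.
apply: (@taylor_chain_intro R _ r d (K + v 0) rho^-1 d0 _ Hrec) => [h _|N h hd].
  by rewrite Hr.
apply: le_trans (rb N h hd) _; case: N => [|N]; first by rewrite Hb expr0 mulr1; lra.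
rewrite exprVn ler_pdivlMr ?exprn_gt0//.
have := SN N.+1; rewrite big_ord_recr /= => H.
have : 0 <= \sum_(i < N) y i by apply: sumr_ge0.
by rewrite -/(y N); lra.
Qed.
End Germs.

(** * Analytic functions on an interval *)

Section PowerSeries.
Variable R : realType.

Lemma cvg_dist_le (u : nat -> R) (l c e : R) (N : nat) : u @ \oo --> l ->
  (forall n, (N <= n)%N -> `|u n - c| <= e) -> `|l - c| <= e.
Proof.
move=> ul H; apply/ler_addgt0Pl => x x0.
have un := (iffLR (cvgrPdist_lt _ _)) ul x x0.
near \oo => n.
have h1 : `|l - u n| < x by near: n; exact: un.
have h2 : `|u n - c| <= e by apply: H; near: n; exact: nbhs_infty_ge.
rewrite (_ : l - c = (l - u n) + (u n - c)); last by ring.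
apply: (le_trans (ler_normD _ _)); lra.
Unshelve. all: by end_near. Qed.

(** The difference quotients are the tails of the series divided by [h ^+ N]. Halving the radius
    twice makes the tails geometric with ratio at most 1/2. *)
Lemma power_series_analytic0 (f : R -> R) (a : nat -> R) (r : R) : 0 < r ->
  (forall h : R, `|h| < r ->
    (fun N : nat => \sum_(k < N) a k * h ^+ k) @ \oo --> f h) -> analytic0 f.
Proof.
move=> r0 H; pose rho := r / 2; have rho0 : 0 < rho by rewrite divr_gt0.
have [M M0 HM] : exists2 M : R, 0 <= M & forall k, `|a k| * rho ^+ k <= M.
  have [|B [Br HB]] := @cvg_seq_bounded _ _ (fun N : nat => \sum_(k < N) a k * rho ^+ k).
    by apply/cvg_ex; exists (f rho); apply: H; rewrite gtr0_norm// /rho; lra.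
  have HB1 n : `|\sum_(k < n) a k * rho ^+ k| <= B + 1 by apply: HB => //; lra.
  exists (2 * (B + 1)) => [|k]; first by have := HB1 0%N; rewrite big_ord0 normr0; lra.
  have := HB1 k; have := HB1 k.+1; rewrite big_ord_recr /=; set S := \sum_(_ < _) _.
  move=> h1 h2; rewrite -(ger0_norm (exprn_ge0 k (ltW rho0))) -normrM.
  rewrite (_ : a k * rho ^+ k = (S + a k * rho ^+ k) - S); last by ring.
  by apply: (le_trans (ler_normB _ _)); lra.
have main N h : `|h| < rho / 2 ->
    `|f h - \sum_(k < N) a k * h ^+ k| <= 2 * M * (`|h| / rho) ^+ N.
  move=> hd; have hr : `|h| < r by move: hd; rewrite /rho; lra.
  have q0 : 0 <= `|h| / rho by rewrite divr_ge0// ltW.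
  have q1 : 2 * (`|h| / rho) <= 1 by rewrite mulrA ler_pdivrMr//; lra.
  apply: (cvg_dist_le (N := N) (H h hr)) => n /subnKC <-.
  rewrite big_split_ord /= addrAC subrr add0r.
  apply: (le_trans (ler_norm_sum _ _ _)).
  apply: (@le_trans _ _ (\sum_(i < n - N) M * (`|h| / rho) ^+ N * (`|h| / rho) ^+ i)).
    apply: ler_sum => i _; rewrite normrM normrX -mulrA -exprD exprMn exprVn.
    rewrite mulrA [leRHS]mulrAC ler_wpM2r ?exprn_ge0//.
    by rewrite ler_pdivlMr ?exprn_gt0.
  rewrite -mulr_sumr -[2 * M * _]mulrA [leRHS]mulrC.
  apply: ler_wpM2l; first by rewrite mulr_ge0// exprn_ge0.
  exact: geometric_sum_le2.
have d0 : 0 < rho / 2 by rewrite divr_gt0.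
have a0 : f 0 = a 0%N.
  have := main 1%N 0; rewrite normr0 mul0r expr1 mulr0 big_ord1 expr0 mulr1.
  by move=> /(_ d0); rewrite normr_le0 subr_eq0 => /eqP.
(* The value at 0 must be the coefficient itself: the recursion of a Taylor chain refers to it. *)
pose rr N (h : R) := if h == 0 then a N else (f h - \sum_(k < N) a k * h ^+ k) / h ^+ N.
apply: (@taylor_chain_intro _ f rr (rho / 2) (2 * M) rho^-1 d0).
- move=> h _; rewrite /rr; case: eqP => [->//|_].
  by rewrite big_ord0 subr0 expr0 divr1.
- move=> N h _; rewrite /rr eqxx; case: eqVneq => [->|h0]; first by rewrite mul0r addr0.
  rewrite big_ord_recr /= exprS; field.
  by rewrite h0 expf_neq0.
- move=> N h hd; rewrite /rr; case: eqVneq => [_|h0].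
    rewrite exprVn ler_pdivlMr ?exprn_gt0//; have := HM N; lra.
  rewrite normrM normfV normrX ler_pdivrMr ?exprn_gt0 ?normr_gt0//.
  apply: le_trans (main N h hd) _.
  by rewrite [leRHS]mulrAC -[leRHS]mulrA -exprMn.
Qed.

Lemma geometric_cvg (u : nat -> R) (l B q : R) : 0 <= q < 1 ->
  (forall N, `|l - u N| <= B * q ^+ N) -> u @ \oo --> l.
Proof.
move=> /andP[q0 q1] H.
have c0 : (fun N : nat => B * q ^+ N) @ \oo --> (B * 0 : R).
  by apply: cvgM; [exact: cvg_cst|apply: cvg_expr; rewrite ger0_norm].
rewrite mulr0 in c0.
apply/cvgrPdist_lt => e e0; move/cvgr0Pnorm_lt: c0 => /(_ e e0); apply: filterS => N.
by apply: le_lt_trans; apply: le_trans (H N) (ler_norm _).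
Qed.

Lemma taylor_chain_cvg (f : R -> R) (K : R) r (h : R) : taylor_chain f K r -> `|h| * K < 1 ->
  (fun N : nat => \sum_(k < N) r k 0 * h ^+ k) @ \oo --> f h.
Proof.
move=> Hr hK; have [K1 /(_ h hK)[_ Hb]] := Hr.
apply: (@geometric_cvg _ _ K (`|h| * K)) => [|N]; first by rewrite mulr_ge0//; lra.
rewrite (taylor_chain_expand N Hr hK) addrAC subrr add0r normrM normrX.
by rewrite exprMn mulrCA -exprS ler_wpM2l// (Hb N).2.
Qed.

End PowerSeries.

(** * Connectedness: the identity theorem and coherent signs *)

Section OnInterval.
Variables (R : realType) (D : set R).
Hypothesis Ditv : is_interval D.
Hypothesis Dopen : forall t, D t -> near0 (fun h => D (t + h)).

Definition analytic_at (f : R -> R) t := analytic0 (fun h => f (t + h)).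
Definition analytic_in (f : R -> R) := forall t, D t -> analytic_at f t.

Lemma ranalytic_onP (f : R -> R) : ranalytic_on D f <-> analytic_in f.
Proof.
split=> H t Dt.
  have [r [r0 [a Ha]]] := H t Dt; have [d d0 Hd] := Dopen Dt.
  apply: (@power_series_analytic0 _ _ a (Num.min r d)); first by rewrite lt_min r0.
  move=> h; rewrite lt_min => /andP[hr /Hd Dh].
  by have := Ha _ Dh; rewrite addrC addKr; apply.
have [K [r Hr]] := H t Dt; have K1 := Hr.1.
exists K^-1; split; first by rewrite invr_gt0; lra.
exists (fun k => r k 0) => s Ds st.
have -> : f s = f (t + (s - t)) by congr f; ring.
apply: (taylor_chain_cvg Hr); rewrite -ltr_pdivlMr ?div1r//; exact: lt_le_trans K1.
Qed.

Lemma near0_nbhs (A : set R) t : near0 (fun h => A (t + h)) -> nbhs t A.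
Proof.
move=> [d d0 H]; apply/nbhs_ballP; exists d => //= s.
by rewrite /ball /= => ts; rewrite -(subrKC t s); apply: H; rewrite distrC.
Qed.

(** Both [P] and its negation cut out open subsets of the connected set [D]. This carries local
    facts about germs along the whole interval. *)
Lemma locally_constant (P : R -> Prop) x y :
  (forall t, D t -> near0 (fun h => P (t + h) <-> P t)) ->
  D x -> D y -> P x -> P y.
Proof.
move=> HP Dx Dy Px.
have cD : connected D by apply/connected_intervalP.
have oA (Q : R -> Prop) : (forall t, D t -> near0 (fun h => Q (t + h) <-> Q t)) ->
    open [set t | D t /\ Q t].
  move=> HQ; rewrite openE => t [Dt Qt]; apply: near0_nbhs.
  by apply: near0W (near0I (Dopen Dt) (HQ t Dt)) => h [Dh [_ Qh]]; split; [|exact: Qh].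
suff e : [set t | D t /\ P t] = D by have : D y by []; rewrite -e => -[].
apply: cD.
- by exists x.
- by exists [set t | D t /\ P t]; [exact: oA|apply/seteqP; split=> t /= []; [|move=> _ []]].
- exists (~` [set t | D t /\ ~ P t]).
    apply: open_closedC; apply: oA => t /HP; apply: near0W => h [h1 h2].
    by split=> hn hp; apply: hn; [exact: h2|exact: h1].
  apply/seteqP; split=> t /=.
    by move=> [Dt Pt]; split=> // -[].
  by move=> [Dt Pt]; split=> //; apply: contrapT => nP; apply: Pt.
Qed.

Lemma analytic_not_near0 (f : R -> R) c : analytic_in f -> D c -> f c != 0 ->
  forall t, D t -> ~ near0 (fun h => f (t + h) = 0).
Proof.
move=> af Dc fc t Dt fnull; move/eqP: fc; apply.
rewrite -(addr0 c); apply: (near0_self (P := fun h => f (c + h) = 0)).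
apply: (@locally_constant (fun t => near0 (fun h => f (t + h) = 0))) fnull => // {Dt}t Dt.
have [[d d0 H]|[p [u [au u0 Hf]]]] := analytic0_order (af t Dt).
  exists d => // h hd; split=> _; first by exists d.
  exists (d - `|h|) => [|k kd]; first by rewrite subr_gt0.
  by rewrite -addrA H//; apply: (le_lt_trans (ler_normD _ _)); lra.
have [d d0 H] := near0I Hf (analytic0_neq0 au u0).
have nz k : `|k| < d -> k != 0 -> f (t + k) != 0.
  by move=> kd k0; have [-> uk] := H k kd; rewrite mulf_neq0// expf_neq0.
exists d => // h hd; have [->|h0] := eqVneq h 0; first by rewrite addr0.
split=> [/near0_self|[e e0 He]]; first by rewrite addr0 => f0; move: (nz h hd h0); rewrite f0 eqxx.
(* At [t + k] the function vanishes by the null germ at [t], and does not vanish by its finite order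
   there. *)
exfalso; pose k := Num.min d e / 2.
have m0 : 0 < Num.min d e by rewrite lt_min d0.
have km : `|k| < Num.min d e by rewrite gtr0_norm ?divr_gt0// /k; lra.
move: km; rewrite lt_min => /andP[kd ke].
by move: (nz k kd); rewrite He// eqxx gt_eqF ?divr_gt0// => /(_ isT).
Qed.

(** [Z] has no accumulation point in [D], so only finitely many of its points lie between two points
    of [D], and the sign can count them modulo 2. Counting over []x, y]] makes the sign
    right-continuous, which is why the jump at a point of [Z] shows for [h < 0]. *)
Lemma sign_function (Z : set R) :
  (forall t, D t -> near0 (fun h => h != 0 -> ~ Z (t + h))) ->
  exists s : R -> R, (forall t, s t ^+ 2 = 1) /\
    forall t, D t -> near0 (fun h =>
      s (t + h) = s t * (if (h < 0) && `[<Z t>] then -1 else 1)).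
Proof.
move=> HZ; have [[c Dc]|nD] := pselect (exists c, D c); last first.
  exists (fun=> 1); split=> [t|t Dt]; first by rewrite expr1n.
  by exfalso; apply: nD; exists t.
pose E x y := [set z | x < z <= y /\ Z z].
(* Finiteness is a locally constant property of the endpoint: moving it slightly around [t] adds or
   removes at most the point [t]. *)
have finc y : D y -> finite_set (E c y) /\ finite_set (E y c).
  move=> Dy; pose P y := finite_set (E c y) /\ finite_set (E y c).
  apply: (@locally_constant P c y) => // [t Dt|]; last first.
    rewrite /P (_ : E c c = set0)// -subset0 => z [/andP[z1 z2] _].
    by move: (lt_le_trans z1 z2); rewrite ltxx.
  have [d d0 Hd] := HZ t Dt; exists d => // h hd.
  have far z : Z z -> z != t -> d <= `|z - t|.
    move=> Zz zt; rewrite leNgt; apply/negP => zd.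
    by have := Hd _ zd; rewrite subr_eq0 subrKC => /(_ zt).
  have fs A B : A `<=` B `|` [set t] -> finite_set B -> finite_set A.
    by move=> AB fB; apply: sub_finite_set AB _; rewrite finite_setU; split.
  move: hd; rewrite ltr_norml => /andP[h1 h2].
  have sub a b a' b' : (a' = a \/ a' = t /\ a = t + h \/ a' = t + h /\ a = t) ->
      (b' = b \/ b' = t /\ b = t + h \/ b' = t + h /\ b = t) ->
      E a b `<=` E a' b' `|` [set t].
    move=> Ha Hb z [/andP[az zb] Zz]; have [->|zt] := eqVneq z t; first by right.
    left; split=> //; have := far z Zz zt; rewrite ler_normr => /orP zd.
    apply/andP; split.
      by case: Ha => [->//|[[-> e]|[-> e]]]; rewrite e in az; lra.
    by case: Hb => [->//|[[-> e]|[-> e]]]; rewrite e in zb; lra.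
  split=> -[f1 f2]; split.
  - by apply: fs f1; apply: sub; auto.
  - by apply: fs f2; apply: sub; auto.
  - by apply: fs f1; apply: sub; auto.
  - by apply: fs f2; apply: sub; auto.
have finE x y : D x -> D y -> finite_set (E x y).
  move=> Dx Dy; apply: (@sub_finite_set _ _ (E c y `|` E x c)).
    move=> z [/andP[xz zy] Zz]; have [zc|cz] := leP z c; [right|left]; split=> //.
      by rewrite xz.
    by rewrite cz.
  by rewrite finite_setU; split; [exact: (finc y Dy).1|exact: (finc x Dx).2].
(* [s t] below is the parity of the number of points of [Z] between [c] and [t] *)
pose W (x y : R) : R := \big[*%R/(1 : R)]_(z \in E x y) (-1 : R).
have W2 x y : W x y * W x y = 1.
  suff [->|->] : W x y = 1 \/ W x y = -1 by rewrite ?mulr1 ?mulrNN ?mulr1.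
  rewrite /W; apply: (big_ind (fun x : R => x = 1 \/ x = -1)); [by left| |by right].
  by move=> a b [->|->] [->|->]; rewrite ?mulrNN ?mulr1 ?mul1r; auto.
have W1 x y : y <= x -> W x y = 1.
  move=> yx; rewrite /W (_ : E x y = set0) ?fsbig_set0// -subset0.
  by move=> z [/andP[z1 z2] _]; have := lt_le_trans z1 (le_trans z2 yx); rewrite ltxx.
have WM x y z : D x -> D y -> D z -> x <= y -> y <= z -> W x z = W x y * W y z.
  move=> Dx Dy Dz xy yz; rewrite /W.
  rewrite (_ : E x z = E x y `|` E y z) ?fsbigU0//; try exact: finE.
    by move=> w [[/andP[_ w1] _] [/andP[w2 _] _]]; have := lt_le_trans w2 w1; rewrite ltxx.
  apply/seteqP; split=> w.
    move=> [/andP[w1 w2] Zw]; have [wy|yw] := leP w y; [left|right]; split=> //.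
      by rewrite w1.
    by rewrite yw.
  move=> [[/andP[w1 w2] Zw]|[/andP[w1 w2] Zw]]; split=> //.
    by rewrite w1 (le_trans w2).
  by rewrite w2 andbT (le_lt_trans xy).
(* One factor ranges over an empty interval and equals 1, so a single formula covers both sides of
   [c]. *)
pose s t := W c t * W t c.
have sW x y : D x -> D y -> x <= y -> s y = s x * W x y.
  move=> Dx Dy xy; rewrite /s; have [cx|xc] := leP c x.
    by rewrite (W1 y c) ?(le_trans cx)// (W1 x c)// !mulr1 (WM c x y).
  have [cy|yc] := leP c y.
    rewrite (W1 y c)// (W1 c x) ?ltW// (WM x c y) ?(ltW xc)//.
    by rewrite mul1r mulr1 mulrA W2 mul1r.
  rewrite (W1 c y) ?ltW// (W1 c x) ?ltW// !mul1r (WM x y c) ?(ltW yc)//.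
  by rewrite mulrAC W2 mul1r.
exists s; split=> [t|t Dt]; first by rewrite expr2 /s mulrACA !W2 mulr1.
have [d d0 Hd] := near0I (HZ t Dt) (Dopen Dt).
exists d => // h hd; have [_ Dh] := Hd h hd.
have far z : Z z -> z != t -> d <= `|z - t|.
  move=> Zz zt; rewrite leNgt; apply/negP => zd.
  by have [+ _] := Hd _ zd; rewrite subr_eq0 subrKC => /(_ zt).
have [h0|h0] /= := ltP h 0; last first.
  rewrite mulr1 (sW t) ?lerDl// /W (_ : E _ _ = set0) ?fsbig_set0 ?mulr1//.
  rewrite -subset0 => z [/andP[z1 z2] Zz].
  have := far z Zz; rewrite gt_eqF// => /(_ isT).
  by move: hd; rewrite ger0_norm// gtr0_norm ?subr_gt0//; lra.
rewrite (sW (t + h) t) ?gerDl ?ltW//.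
have -> : W (t + h) t = if `[<Z t>] then -1 else 1.
  rewrite /W; case: asboolP => Zt.
    rewrite (_ : E _ _ = [set t]) ?fsbig_set1//; apply/seteqP; split=> z /=; last first.
      by move=> ->; split=> //; rewrite lexx andbT gtrDl.
    move=> [/andP[z1 z2] Zz]; have [//|zt] := eqVneq z t.
    have := far z Zz zt; move: hd; rewrite ltr0_norm// ler0_norm ?subr_le0//; lra.
  rewrite (_ : E _ _ = set0) ?fsbig_set0// -subset0 => z [/andP[z1 z2] Zz].
  have zt : z != t by apply: contra_not_neq Zt => <-.
  have := far z Zz zt; move: hd; rewrite ltr0_norm// ler0_norm ?subr_le0//; lra.
by case: asboolP; rewrite ?mulr1// mulrAC mulrN1 mulrN1 ?opprK.
Qed.
End OnInterval.

(** * Global square roots and quotients *)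

Section Roots.
Variables (R : realType) (D : set R).
Hypothesis Ditv : is_interval D.
Hypothesis Dopen : forall t, D t -> near0 (fun h => D (t + h)).

Lemma analytic0_ge0 (f : R -> R) : analytic0 f ->
  near0 (fun h => h != 0 -> 0 <= f h) -> 0 <= f 0.
Proof.
move=> af fge; rewrite leNgt; apply/negP => f0.
have [|d d0 H] := near0I fge (@analytic0_gt0 _ (fun h => - f h) (analytic0N af) _).
  by rewrite oppr_gt0.
have d20 : 0 < d / 2 by rewrite divr_gt0.
have [|] := H (d / 2); first by rewrite gtr0_norm//; lra.
by rewrite gt_eqF// => /(_ isT) + /=; lra.
Qed.

(** A point [h > 0] fixes the sign of [u 0]; a point [h < 0] then excludes an odd exponent. *)
Lemma analytic0_even_order (f : R -> R) : analytic0 f -> near0 (fun h => 0 <= f h) ->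
  ~ near0 (fun h => f h = 0) ->
  exists p u, [/\ analytic0 u, 0 < u 0 & near0 (fun h => f h = h ^+ p.*2 * u h)].
Proof.
move=> af fge fn0; have [//|[q [u [au u0 Hf]]]] := analytic0_order af.
have nu0 : 0 < `|u 0| by rewrite normr_gt0.
have [d d0 H] := near0I (near0I Hf fge) (analytic0_near_ball au nu0).
have d20 : 0 < d / 2 by rewrite divr_gt0.
have u0gt : 0 < u 0.
  have [|[-> /=]] := H (d / 2); first by rewrite gtr0_norm//; lra.
  rewrite pmulr_rge0 ?exprn_gt0// => uh uu.
  rewrite lt_neqAle eq_sym u0 leNgt; apply/negP => u0lt.
  by move: uu; rewrite (ltr0_norm u0lt) ltr_norml => /andP[_]; lra.
have q_even : ~~ odd q.
  have [|[-> /=]] := H (- (d / 2)); first by rewrite normrN gtr0_norm//; lra.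
  rewrite (gtr0_norm u0gt) ltr_norml => le0 /andP[u1 _].
  have uh : 0 < u (- (d / 2)) by lra.
  apply/negP => oq; move: le0; rewrite pmulr_lge0// exprn_odd_ge0//; lra.
exists q./2, u; split=> //; apply: near0W Hf => h ->.
by rewrite -[in LHS](odd_double_half q) (negbTE q_even).
Qed.

(* The square root is [Num.sqrt (f t)] up to a sign that flips at the zeros of
   [f] of order 2 mod 4. *)
Lemma analytic_sqrt (f : R -> R) c : analytic_in D f -> (forall t, D t -> 0 <= f t) ->
  D c -> f c != 0 ->
  exists g : R -> R, (forall t, D t -> g t ^+ 2 = f t) /\
    forall t, D t -> exists p v, [/\ analytic0 v, v 0 != 0 &
      near0 (fun h => g (t + h) = h ^+ p * v h)].
Proof.
move=> af fge Dc fc.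
have Hp t : exists p, D t -> exists u, [/\ analytic0 u, 0 < u 0 &
    near0 (fun h => f (t + h) = h ^+ p.*2 * u h)].
  have [Dt|] := pselect (D t); last by exists 0%N.
  have [||p Hp] := analytic0_even_order (af t Dt).
  - by apply: near0W (Dopen Dt) => h /fge.
  - exact: (analytic_not_near0 Ditv Dopen af Dc fc).
  - by exists p => _.
have [pf {}Hp] := choice Hp.
pose Z := [set t | odd (pf t)].
(* Around [t] the function is nonzero except possibly at [t], so nearby points have order 0, which
   is even. *)
have HZ t : D t -> near0 (fun h => h != 0 -> ~ Z (t + h)).
  move=> Dt; have [u [au u0 Hf]] := Hp t Dt.
  have := near0I (Dopen Dt) (near0I Hf (analytic0_gt0 au u0)).
  apply: near0W => h [Dh [fh uh]] h0; rewrite /Z /=.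
  have [w [_ _ /near0_self]] := Hp _ Dh; rewrite addr0 fh.
  case: (pf (t + h)) => // p /eqP; rewrite doubleS expr0n mul0r.
  by rewrite mulf_eq0 expf_eq0 (negbTE h0) andbF (gt_eqF uh).
have [s [s2 Hs]] := sign_function Ditv Dopen HZ.
exists (fun t => s t * Num.sqrt (f t)); split=> t Dt.
  by rewrite exprMn s2 mul1r sqr_sqrtr// fge.
have [u [au u0 Hf]] := Hp t Dt; exists (pf t), (fun h => s t * Num.sqrt (u h)).
have sn0 : s t != 0 by rewrite -sqrf_eq0 s2 oner_eq0.
split.
- by apply: analytic0M; [exact: analytic0_cst|exact: analytic0_sqrt].
- by rewrite mulf_neq0// gt_eqF// sqrtr_gt0.
apply: near0W (near0I (Hs t Dt) Hf) => h [-> ->].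
rewrite -muln2 exprM sqrtrM ?sqr_ge0// sqrtr_sqr normrX.
(* The real root of [h ^+ (pf t).*2] is [|h| ^+ pf t], which differs from [h ^+ pf t] by a sign
   exactly when [h < 0] and [pf t] is odd. The jump of [s] cancels it. *)
rewrite (_ : `|h| ^+ pf t = h ^+ pf t * (if (h < 0) && `[<Z t>] then -1 else 1)).
  case: ifP => _; ring.
rewrite (_ : `[<Z t>] = odd (pf t)); last by apply/asboolP/idP.
case: ltP => h0 /=; last by rewrite mulr1 ger0_norm.
rewrite ltr0_norm// exprNn mulrC -signr_odd; case: odd; rewrite ?expr1 ?expr0//.
Qed.

(** The inequality bounds [f] near each point by a multiple of the power of [h] dividing [g], so the
    quotient exists locally. Local quotients agree because [g] is nonzero in a punctured
    neighbourhood. *)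
Lemma analytic_quotient (g f b : R -> R) :
  (forall t, D t -> exists p v, [/\ analytic0 v, v 0 != 0 &
     near0 (fun h => g (t + h) = h ^+ p * v h)]) ->
  analytic_in D f -> analytic_in D b ->
  (forall t, D t -> f t ^+ 2 <= g t ^+ 2 * b t) ->
  exists2 q : R -> R, analytic_in D q & forall t, D t -> q t * g t = f t.
Proof.
move=> Hg af ab fgb.
have loc t : exists q : R -> R, D t -> analytic0 q /\
    near0 (fun h => q h * g (t + h) = f (t + h)).
  have [Dt|] := pselect (D t); last by exists (fun=> 0).
  have [p [v [av v0 gv]]] := Hg t Dt.
  have [M M0 HM] := analytic0_bounded (analytic0M (analytic0X 2 av) (ab t Dt)).
  (* [1 + M] serves because [M <= (1 + M) ^+ 2], which avoids a square root. *)
  have [||w aw Hw] := @analytic0_divX _ (fun h => f (t + h)) p (1 + M).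
  - exact: af.
  - apply: near0W (near0I (Dopen Dt) (near0I gv HM)) => h [Dh [gh bh]].
    have := fgb _ Dh; rewrite gh exprMn -mulrA => fh.
    rewrite -(@ler_pXn2r _ 2)// ?nnegrE//; last by rewrite mulr_ge0// ?exprn_ge0//; lra.
    rewrite real_normK ?num_real//; apply: le_trans fh _.
    rewrite [leRHS]exprMn -normrX real_normK ?num_real// [leRHS]mulrC.
    apply: ler_wpM2l; first exact: sqr_ge0.
    by apply: le_trans (ler_norm _) _; apply: le_trans bh _; nra.
  exists (fun h => w h * (v h)^-1) => _; split.
    by apply: analytic0M => //; exact: analytic0V.
  apply: near0W (near0I gv (near0I Hw (analytic0_neq0 av v0))) => h [-> [-> vh]].
  by rewrite mulrCA -mulrA mulVf// mulr1 mulrC.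
have [Q HQ] := choice loc.
(* At a zero of [g] the ratio is undetermined, so each point takes the central value of its own
   local quotient. *)
exists (fun t => Q t 0) => t Dt; last first.
  by have [_ /near0_self] := HQ t Dt; rewrite addr0.
have [aQ Qg] := HQ t Dt; apply: analytic0_near aQ.
have [p [v [av v0 gv]]] := Hg t Dt.
apply: near0W (near0I (near0I (Dopen Dt) Qg) (near0I gv (analytic0_neq0 av v0))).
move=> h [[Dh Qh] [gh vh]].
have [->|h0] := eqVneq h 0; first by rewrite addr0.
have gn0 : g (t + h) != 0 by rewrite gh mulf_neq0// expf_neq0.
apply: (mulIf gn0); rewrite Qh.
by have [_ /near0_self] := HQ _ Dh; rewrite addr0.
Qed.
End Roots.

(** * Positive semidefinite matrices *)

Section Psd.
Variable R : realType.
Local Notation C := R[i].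
Local Notation Re := complex.Re.
Local Notation Im := complex.Im.

Lemma Re_conj (z : C) : Re (Num.conj z) = Re z. Proof. by case: z. Qed.
Lemma Im_conj (z : C) : Im (Num.conj z) = - Im z. Proof. by case: z. Qed.
Lemma Re_mul (z w : C) : Re (z * w) = Re z * Re w - Im z * Im w.
Proof. by case: z w => [a b] [c d]. Qed.
Lemma Im_mul (z w : C) : Im (z * w) = Re z * Im w + Im z * Re w.
Proof. by case: z w => [a b] [c d]. Qed.
Lemma Re_add (z w : C) : Re (z + w) = Re z + Re w.
Proof. by case: z w => [a b] [c d]. Qed.
Lemma Im_add (z w : C) : Im (z + w) = Im z + Im w.
Proof. by case: z w => [a b] [c d]. Qed.
Lemma Re_opp (z : C) : Re (- z) = - Re z. Proof. by case: z. Qed.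
Lemma Im_opp (z : C) : Im (- z) = - Im z. Proof. by case: z. Qed.
Definition ReImE := (Re_add, Im_add, Re_opp, Im_opp, Re_mul, Im_mul, Re_conj, Im_conj).
Lemma complex_eqP (z w : C) : Re z = Re w -> Im z = Im w -> z = w.
Proof. by case: z w => [a b] [c d] /= -> ->. Qed.

Lemma adjmxM m n p (A : 'M[C]_(m, n)) (B : 'M[C]_(n, p)) :
  adjmx (A *m B) = adjmx B *m adjmx A.
Proof. by rewrite /adjmx trmx_mul map_mxM. Qed.

Lemma adjmxK m n (A : 'M[C]_(m, n)) : adjmx (adjmx A) = A.
Proof. by apply/matrixP => i j; rewrite !mxE conjCK. Qed.

Lemma adjmxD m n (A B : 'M[C]_(m, n)) : adjmx (A + B) = adjmx A + adjmx B.
Proof. by apply/matrixP => i j; rewrite !mxE rmorphD. Qed.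

Lemma adjmxN m n (A : 'M[C]_(m, n)) : adjmx (- A) = - adjmx A.
Proof. by apply/matrixP => i j; rewrite !mxE rmorphN. Qed.

Lemma adjmxZ m n (a : C) (A : 'M[C]_(m, n)) : adjmx (a *: A) = Num.conj a *: adjmx A.
Proof. by apply/matrixP => i j; rewrite !mxE rmorphM. Qed.

Lemma adjmx_delta m n (i : 'I_m) (j : 'I_n) :
  adjmx (delta_mx i j : 'M[C]_(m, n)) = delta_mx j i.
Proof. by apply/matrixP => k l; rewrite !mxE andbC rmorph_nat. Qed.

Lemma form_delta N (A : 'M[C]_N) i j :
  (adjmx (delta_mx i 0 : 'cV[C]_N) *m A *m (delta_mx j 0 : 'cV[C]_N)) 0 0 = A i j.
Proof. by rewrite adjmx_delta -rowE -colE !mxE. Qed.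

Lemma addmxE m n (A B : 'M[C]_(m, n)) i j : (A + B) i j = A i j + B i j.
Proof. by rewrite mxE. Qed.
Lemma oppmxE m n (A : 'M[C]_(m, n)) i j : (- A) i j = - A i j.
Proof. by rewrite mxE. Qed.
Lemma scalemxE m n a (A : 'M[C]_(m, n)) i j : (a *: A) i j = a * A i j.
Proof. by rewrite mxE. Qed.
Lemma adjmxE m n (A : 'M[C]_(m, n)) i j : adjmx A i j = Num.conj (A j i).
Proof. by rewrite !mxE. Qed.

Lemma psd_form N (A : 'M[C]_N) i j (a : C) : psdmx A ->
  0 <= A i i + Num.conj a * A j i + (a * A i j + Num.conj a * (a * A j j)).
Proof.
move=> /(_ (delta_mx i 0 + a *: delta_mx j 0)).
rewrite adjmxD adjmxZ !(mulmxDl, mulmxDr) -?(scalemxAl, scalemxAr).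
by rewrite -?(scalemxAl, scalemxAr) !(addmxE, scalemxE) !form_delta.
Qed.

Lemma psd_diag N (A : 'M[C]_N) i : psdmx A -> 0 <= Re (A i i) /\ Im (A i i) = 0.
Proof.
move=> /(psd_form i i 0); rewrite rmorph0 !mul0r !addr0 lecE /=.
by move=> /andP[/eqP ? ?]; split.
Qed.

Lemma psd_hermitian N (A : 'M[C]_N) i j : psdmx A -> A j i = Num.conj (A i j).
Proof.
move=> pA; have [_ Ai] := psd_diag i pA; have [_ Aj] := psd_diag j pA.
have := psd_form i j 1 pA; have := psd_form i j (Complex 0 1) pA.
rewrite !lecE => /andP[/eqP + _] /andP[/eqP + _].
rewrite !ReImE /= Ai Aj => e1 e2.
by apply: complex_eqP; rewrite ?Re_conj ?Im_conj; lra.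
Qed.

Definition sqnorm (z : C) : R := Re z ^+ 2 + Im z ^+ 2.

(** The form at [e_i - s * conj (A i j) e_j], with [s] real, is a real quadratic polynomial in [s]
    that is never negative; [s = 1 / A j j] minimises it when [A j j] is nonzero. *)
Lemma psd_cauchy N (A : 'M[C]_N) i j : psdmx A ->
  sqnorm (A i j) <= Re (A i i) * Re (A j j).
Proof.
move=> pA; have [ai Ai] := psd_diag i pA; have [aj Aj] := psd_diag j pA.
have H (s : R) : 0 <= Re (A i i) - 2 * s * sqnorm (A i j) + s ^+ 2 * sqnorm (A i j) * Re (A j j).
  have := psd_form i j (- (Complex s 0) * Num.conj (A i j)) pA.
  rewrite (psd_hermitian i j pA) lecE => /andP[_].
  rewrite !ReImE /= Aj /sqnorm.
  by move=> /le_trans; apply; rewrite le_eqVlt; apply/orP; left; apply/eqP; ring.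
have x0 : 0 <= sqnorm (A i j) by rewrite addr_ge0// sqr_ge0.
move: H x0 ai aj; move: (sqnorm _) (Re (A i i)) (Re (A j j)) => x a b H x0 a0 b0.
have [->|xn0] := eqVneq x 0; first exact: mulr_ge0.
have [b00|bn0] := eqVneq b 0.
  (* For [b = 0] the polynomial is affine in [s], and it takes the value -1 here. *)
  have := H ((a + 1) / (2 * x)); rewrite b00 mulr0 addr0.
  rewrite (_ : 2 * ((a + 1) / (2 * x)) * x = a + 1); last by field.
  by lra.
have := H b^-1.
rewrite (_ : a - 2 * b^-1 * x + b^-1 ^+ 2 * x * b = a - x / b); last by field.
by rewrite subr_ge0 ler_pdivrMr// lt_neqAle eq_sym bn0.
Qed.

Lemma psd_diag0 N (A : 'M[C]_N) : psdmx A -> (forall i, Re (A i i) = 0) -> A = 0.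
Proof.
move=> pA A0; apply/matrixP => i j; rewrite mxE.
have := psd_cauchy i j pA; rewrite !A0 mulr0 => H.
have := sqr_ge0 (Re (A i j)); have := sqr_ge0 (Im (A i j)) => h1 h2.
by apply: complex_eqP; apply/eqP; rewrite -sqrf_eq0 eq_le; apply/andP; split=> //;
  move: H; rewrite /sqnorm /=; lra.
Qed.

(** Completing the square: the form of [A - k k^*] at [v] equals the form of [A] at
    [v - (b / g) e_i] with [b = k^* v], the shift that minimises the form of [A] along [e_i]. *)
Lemma schur_psd N (A : 'M[C]_N) i (k : 'cV[C]_N) (g : R) : psdmx A -> g != 0 ->
  (forall j, k j 0 * Complex g 0 = A j i) -> Re (A i i) = g ^+ 2 ->
  psdmx (A - k *m adjmx k).
Proof.
move=> pA g0 kg Ag v.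
pose G : C := Complex g 0.
have G0 : G != 0 by rewrite eq_complex /= negb_and g0.
have conjG : Num.conj G = G by apply: complex_eqP; rewrite ?Re_conj ?Im_conj //= oppr0.
have Aii : A i i = G * G.
  apply: complex_eqP; rewrite ?ReImE /=; last by rewrite (psd_diag i pA).2; ring.
  by rewrite Ag; ring.
have Ae : A *m (delta_mx i 0 : 'cV[C]_N) = G *: k.
  by rewrite -colE; apply/matrixP => j l; rewrite !mxE ord1 -kg mulrC.
have eA : adjmx (delta_mx i 0 : 'cV[C]_N) *m A = G *: adjmx k.
  rewrite adjmx_delta -rowE; apply/matrixP => l j; rewrite !mxE ord1.
  by rewrite (psd_hermitian j i pA) -kg -/G rmorphM /= conjG mulrC.
pose b : C := (adjmx k *m v) 0 0.
have bE : adjmx k *m v = b%:M by rewrite [LHS]mx11_scalar.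
have bE' : adjmx v *m k = (Num.conj b)%:M.
  by rewrite [LHS]mx11_scalar -[k]adjmxK -adjmxM bE !mxE.
have := pA (v - (b / G) *: delta_mx i 0).
set e : 'cV[C]_N := delta_mx i 0; set c : C := b / G.
have -> : adjmx (v - c *: e) *m A *m (v - c *: e) =
    adjmx v *m A *m v - c *: (adjmx v *m (A *m e)) - Num.conj c *: (adjmx e *m A *m v)
    + (Num.conj c * c) *: (adjmx e *m A *m e).
  rewrite adjmxD adjmxN adjmxZ !(mulmxBl, mulmxBr) -?(scalemxAl, scalemxAr).
  rewrite -?(scalemxAl, scalemxAr) !mulmxA.
  by apply/matrixP => x y; rewrite !(addmxE, oppmxE, scalemxE); ring.
rewrite !(addmxE, oppmxE, scalemxE) form_delta Aii Ae eA -scalemxAr -scalemxAl.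
have -> : (adjmx v *m (A - k *m adjmx k) *m v) 0 0 =
    (adjmx v *m A *m v) 0 0 - Num.conj b * b.
  rewrite mulmxBr mulmxBl addmxE oppmxE; congr (_ - _).
  by rewrite mulmxA bE' -mulmxA bE -scalar_mxM mxE eqxx mulr1n.
rewrite bE bE' !scalemxE ![_%:M _ _]mxE eqxx !mulr1n.
suff -> : forall z : C, z - c * (G * Num.conj b) - Num.conj c * (G * b) +
   Num.conj c * c * (G * G) = z - Num.conj b * b by [].
have cE : Num.conj c = Num.conj b / G by rewrite /c rmorphM /= fmorphV /= conjG.
by move=> z; rewrite cE /c; field.
Qed.
End Psd.

(** * Analytic matrix functions *)

Section ComplexAnalytic.
Variables (R : realType) (D : set R).
Hypothesis Ditv : is_interval D.
Hypothesis Dopen : forall t, D t -> near0 (fun h => D (t + h)).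
Local Notation C := R[i].
Local Notation Re := complex.Re.
Local Notation Im := complex.Im.

Definition canalytic_in (f : R -> C) :=
  analytic_in D (fun t => Re (f t)) /\ analytic_in D (fun t => Im (f t)).

Lemma canalytic_onP (f : R -> C) : canalytic_on D f <-> canalytic_in f.
Proof. by rewrite /canalytic_on !(ranalytic_onP Dopen). Qed.

Lemma analytic_in_eq (f g : R -> R) :
  (forall t, D t -> f t = g t) -> analytic_in D f -> analytic_in D g.
Proof.
move=> fg af t Dt; apply: analytic0_near (af t Dt).
by apply: near0W (Dopen Dt) => h /fg.
Qed.

Lemma canalytic_eq (f g : R -> C) :
  (forall t, D t -> f t = g t) -> canalytic_in f -> canalytic_in g.
Proof. by move=> fg [a1 a2]; split; [apply: analytic_in_eq a1|apply: analytic_in_eq a2] => t /fg ->. Qed.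

Lemma canalytic_cst (c : C) : canalytic_in (fun=> c).
Proof. by split=> t _; exact: analytic0_cst. Qed.

Lemma canalyticD f g : canalytic_in f -> canalytic_in g -> canalytic_in (fun t => f t + g t).
Proof.
move=> [f1 f2] [g1 g2]; split.
  by under eq_fun do rewrite Re_add; move=> t Dt; apply: analytic0D; [exact: f1|exact: g1].
by under eq_fun do rewrite Im_add; move=> t Dt; apply: analytic0D; [exact: f2|exact: g2].
Qed.

Lemma canalyticN f : canalytic_in f -> canalytic_in (fun t => - f t).
Proof.
move=> [f1 f2]; split.
  by under eq_fun do rewrite Re_opp; move=> t Dt; apply: analytic0N; exact: f1.
by under eq_fun do rewrite Im_opp; move=> t Dt; apply: analytic0N; exact: f2.
Qed.

Lemma canalytic_conj f : canalytic_in f -> canalytic_in (fun t => Num.conj (f t)).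
Proof.
move=> [f1 f2]; split; first by under eq_fun do rewrite Re_conj.
by under eq_fun do rewrite Im_conj; move=> t Dt; apply: analytic0N; exact: f2.
Qed.

Lemma canalyticM f g : canalytic_in f -> canalytic_in g -> canalytic_in (fun t => f t * g t).
Proof.
move=> [f1 f2] [g1 g2]; split.
  under eq_fun do rewrite Re_mul; move=> t Dt; apply: analytic0D.
    by apply: analytic0M; [exact: f1|exact: g1].
  by apply: analytic0N; apply: analytic0M; [exact: f2|exact: g2].
under eq_fun do rewrite Im_mul; move=> t Dt; apply: analytic0D.
  by apply: analytic0M; [exact: f1|exact: g2].
by apply: analytic0M; [exact: f2|exact: g1].
Qed.

Lemma canalytic_sum (I : Type) (r : seq I) (P : pred I) (F : I -> R -> C) :
  (forall i, canalytic_in (F i)) -> canalytic_in (fun t => \sum_(i <- r | P i) F i t).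
Proof.
move=> HF; elim: r => [|i r IH].
  by under eq_fun do rewrite big_nil; exact: canalytic_cst.
under eq_fun do rewrite big_cons.
by case: (P i) => //; apply: canalyticD.
Qed.

Definition mx_analytic_in p q (A : R -> 'M[C]_(p, q)) :=
  forall i j, canalytic_in (fun t => A t i j).

Lemma mx_analyticM p q r (A : R -> 'M[C]_(p, q)) (B : R -> 'M[C]_(q, r)) :
  mx_analytic_in A -> mx_analytic_in B -> mx_analytic_in (fun t => A t *m B t).
Proof.
move=> aA aB i j; under eq_fun do rewrite mxE.
by apply: canalytic_sum => k; apply: canalyticM.
Qed.

Lemma mx_analytic_adj p q (A : R -> 'M[C]_(p, q)) :
  mx_analytic_in A -> mx_analytic_in (fun t => adjmx (A t)).
Proof. by move=> aA i j; under eq_fun do rewrite adjmxE; apply: canalytic_conj. Qed.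

Lemma mx_analyticD p q (A B : R -> 'M[C]_(p, q)) :
  mx_analytic_in A -> mx_analytic_in B -> mx_analytic_in (fun t => A t + B t).
Proof. by move=> aA aB i j; under eq_fun do rewrite addmxE; apply: canalyticD. Qed.

Lemma mx_analyticB p q (A B : R -> 'M[C]_(p, q)) :
  mx_analytic_in A -> mx_analytic_in B -> mx_analytic_in (fun t => A t - B t).
Proof.
move=> aA aB i j; under eq_fun do rewrite addmxE oppmxE.
by apply: canalyticD => //; apply: canalyticN.
Qed.

Lemma mx_analytic_cst p q (A : 'M[C]_(p, q)) : mx_analytic_in (fun=> A).
Proof. by move=> i j; exact: canalytic_cst. Qed.

Definition isolated_zeros (g : R -> R) :=
  forall t, D t -> near0 (fun h => h != 0 -> g (t + h) != 0).

(** The zeros of [g] are isolated, so a closed condition proved where [g] can be divided out extends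
    by continuity. The variants below transfer equalities in the same way. *)
Lemma analytic_ge0_off (g f : R -> R) : isolated_zeros g -> analytic_in D f ->
  (forall t, D t -> g t != 0 -> 0 <= f t) -> forall t, D t -> 0 <= f t.
Proof.
move=> ig af fge t Dt; rewrite -(addr0 t).
apply: (@analytic0_ge0 _ (fun h => f (t + h))); first exact: af.
by apply: near0W (near0I (Dopen Dt) (ig t Dt)) => h [Dh gh] /gh; apply: fge.
Qed.

Lemma analytic_eq0_off (g f : R -> R) : isolated_zeros g -> analytic_in D f ->
  (forall t, D t -> g t != 0 -> f t = 0) -> forall t, D t -> f t = 0.
Proof.
move=> ig af f0 t Dt; apply/eqP; rewrite eq_le; apply/andP; split.
  rewrite -oppr_ge0; apply: (@analytic_ge0_off g (fun t => - f t)) => //.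
    by move=> s Ds; apply: analytic0N; exact: af.
  by move=> s Ds gs; rewrite f0// oppr0.
by apply: (@analytic_ge0_off g f) => // s Ds gs; rewrite f0.
Qed.

Lemma canalytic_eq0_off (g : R -> R) (f : R -> C) : isolated_zeros g -> canalytic_in f ->
  (forall t, D t -> g t != 0 -> f t = 0) -> forall t, D t -> f t = 0.
Proof.
move=> ig [f1 f2] f0 t Dt; apply: complex_eqP.
  by apply: (@analytic_eq0_off g (fun t => Re (f t))) => // s Ds gs; rewrite f0.
by apply: (@analytic_eq0_off g (fun t => Im (f t))) => // s Ds gs; rewrite f0.
Qed.

Lemma mx_analytic_eq0_off p q (g : R -> R) (A : R -> 'M[C]_(p, q)) :
  isolated_zeros g -> mx_analytic_in A ->
  (forall t, D t -> g t != 0 -> A t = 0) -> forall t, D t -> A t = 0.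
Proof.
move=> ig aA A0 t Dt; apply/matrixP => i j; rewrite mxE.
by apply: (@canalytic_eq0_off g (fun t => A t i j)) => // s Ds gs; rewrite A0// mxE.
Qed.

(* By Cauchy-Schwarz the quotient [k] of column [i] by [g] is locally bounded. *)
Lemma psd_column_root N (A : R -> 'M[C]_N) i c : mx_analytic_in A ->
  (forall t, D t -> psdmx (A t)) -> D c -> Re (A c i i) != 0 ->
  exists (g : R -> R) (k : R -> 'cV[C]_N),
    [/\ isolated_zeros g, mx_analytic_in k,
        forall t, D t -> Re (A t i i) = g t ^+ 2 &
        forall t, D t -> forall j, k t j 0 * Complex (g t) 0 = A t j i].
Proof.
move=> aA pA Dc Ac.
have [|g [g2 Hg]] := @analytic_sqrt _ D Ditv Dopen (fun t => Re (A t i i)) c (aA i i).1 _ Dc Ac.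
  by move=> t Dt; exact: (psd_diag i (pA t Dt)).1.
have ig : isolated_zeros g.
  move=> t Dt; have [p [v [av v0 gv]]] := Hg t Dt.
  apply: near0W (near0I gv (analytic0_neq0 av v0)) => h [-> vh] h0.
  by rewrite mulf_neq0// expf_neq0.
have qR j : exists2 q, analytic_in D q & forall t, D t -> q t * g t = Re (A t j i).
  apply: (analytic_quotient Dopen Hg (aA j i).1 (aA j j).1) => t Dt.
  have := psd_cauchy j i (pA t Dt); rewrite g2// mulrC.
  by apply: le_trans; rewrite lerDl sqr_ge0.
have qI j : exists2 q, analytic_in D q & forall t, D t -> q t * g t = Im (A t j i).
  apply: (analytic_quotient Dopen Hg (aA j i).2 (aA j j).1) => t Dt.
  have := psd_cauchy j i (pA t Dt); rewrite g2// mulrC.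
  by apply: le_trans; rewrite lerDr sqr_ge0.
have [a Ha] := choice (fun j => let: ex_intro2 q a b := qR j in ex_intro _ q (conj a b)).
have [b Hb] := choice (fun j => let: ex_intro2 q a b := qI j in ex_intro _ q (conj a b)).
exists g, (fun t => \col_j Complex (a j t) (b j t)); split=> //.
- move=> j l; split; under eq_fun do rewrite mxE /=; [exact: (Ha j).1|exact: (Hb j).1].
- by move=> t Dt; rewrite g2.
- move=> t Dt j; rewrite mxE; apply: complex_eqP; rewrite ?ReImE /=.
    by rewrite mulr0 subr0 (Ha j).2.
  by rewrite mulr0 add0r (Hb j).2.
Qed.

End ComplexAnalytic.

(** * Analytic Cholesky factorization and completion to a unitary *)

Section Factor.
Variables (R : realType) (D : set R).
Hypothesis Ditv : is_interval D.
Hypothesis Dopen : forall t, D t -> near0 (fun h => D (t + h)).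
Local Notation C := R[i].
Local Notation Re := complex.Re.
Local Notation Im := complex.Im.

Lemma psd_gram m N (B : 'M[C]_(m, N)) : psdmx (adjmx B *m B).
Proof.
move=> v; rewrite mulmxA -adjmxM -mulmxA mxE; apply: sumr_ge0 => i _.
by rewrite adjmxE mulrC mul_conjC_ge0.
Qed.

Lemma Re_outer N (k : 'cV[C]_N) j : Re ((k *m adjmx k) j j) = sqnorm (k j 0).
Proof. by rewrite mxE big_ord1 adjmxE !ReImE /sqnorm; ring. Qed.

Lemma psd_eliminate N (A : R -> 'M[C]_N) i : mx_analytic_in D A ->
  (forall t, D t -> psdmx (A t)) ->
  exists2 k : R -> 'cV[C]_N, mx_analytic_in D k &
    forall t, D t -> psdmx (A t - k t *m adjmx (k t)) /\
      Re ((A t - k t *m adjmx (k t)) i i) = 0.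
Proof.
move=> aA pA.
have [[c [Dc Ac]]|A0] := pselect (exists c, D c /\ Re (A c i i) != 0); last first.
  (* The pivot vanishes on all of [D]: nothing is to be eliminated. *)
  exists (fun=> 0) => [|t Dt]; first exact: mx_analytic_cst.
  rewrite mul0mx subr0; split; first exact: pA.
  by apply/eqP; apply: contra_notT A0 => ?; exists t.
have [g [k [ig ak Ag kg]]] := psd_column_root Ditv Dopen aA pA Dc Ac.
exists k => // t Dt.
have aB : mx_analytic_in D (fun t => A t - k t *m adjmx (k t)).
  by apply: mx_analyticB => //; apply: mx_analyticM => //; exact: mx_analytic_adj.
split=> [v|]; last first.
  apply: (analytic_eq0_off Dopen ig (aB i i).1) Dt => s Ds gs.
  rewrite addmxE oppmxE Re_add Re_opp Re_outer Ag// /sqnorm.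
  have := kg s Ds i; have [_ Ai] := psd_diag i (pA s Ds).
  move=> /[dup] /(congr1 (@complex.Re R)) + /(congr1 (@complex.Im R)).
  rewrite !ReImE /= Ag// Ai !mulr0 subr0 add0r expr2 => /(mulIf gs) -> /eqP.
  by rewrite mulf_eq0 (negbTE gs) orbF => /eqP ->; ring.
(* For a fixed [v] positivity is a scalar analytic inequality, so it extends across the zeros of the
   pivot. *)
have af : canalytic_in D (fun t => (adjmx v *m (A t - k t *m adjmx (k t)) *m v) 0 0).
  exact: (mx_analyticM (mx_analyticM (mx_analytic_cst _ (adjmx v)) aB) (mx_analytic_cst _ v)).
have off s : D s -> g s != 0 -> 0 <= (adjmx v *m (A s - k s *m adjmx (k s)) *m v) 0 0.
  by move=> Ds gs; apply: (schur_psd (pA s Ds) gs) => [j|]; [exact: kg|exact: Ag].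
rewrite lecE; apply/andP; split.
  apply/eqP; apply: (analytic_eq0_off Dopen ig af.2) Dt => s Ds gs.
  by have := off s Ds gs; rewrite lecE => /andP[/eqP].
apply: (analytic_ge0_off Dopen ig af.1) Dt => s Ds gs.
by have := off s Ds gs; rewrite lecE => /andP[_].
Qed.

(** Column [i] of [K] is empty, so writing [k] there produces no cross terms. *)
Lemma outer_add N M (K : 'M[C]_(N, M)) (k : 'cV[C]_N) (i : 'I_M) :
  K *m (delta_mx i 0 : 'cV[C]_M) = 0 ->
  (K + k *m delta_mx 0 i) *m adjmx (K + k *m delta_mx 0 i) =
  K *m adjmx K + k *m adjmx k.
Proof.
move=> Ki; rewrite adjmxD adjmxM adjmx_delta mulmxDl !mulmxDr.
rewrite (mulmxA K) Ki mul0mx addr0 -(mulmxA k (delta_mx 0 i) (adjmx K)).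
rewrite -[delta_mx 0 i in X in _ + (X + _)]adjmx_delta -adjmxM Ki.
rewrite -mulmxA (mulmxA (delta_mx 0 i)) mul_delta_mx.
rewrite (_ : adjmx 0 = 0) ?mulmx0 ?add0r; last by apply/matrixP => a b; rewrite !mxE rmorph0.
by congr (_ + _ *m _); apply/matrixP => a b; rewrite !mxE big_ord1 !mxE !ord1 mul1r.
Qed.

(** Only the diagonal of the remainder needs to be tracked: by Cauchy-Schwarz a positive
    semidefinite matrix with zero diagonal is zero. The last clause of the invariant keeps a column
    of [K] free for each later pivot. *)
Lemma psd_factor N (A : R -> 'M[C]_N) : mx_analytic_in D A ->
  (forall t, D t -> psdmx (A t)) ->
  exists2 K : R -> 'M[C]_N, mx_analytic_in D K &
    forall t, D t -> A t = K t *m adjmx (K t).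
Proof.
move=> aA pA.
suff step m : (m <= N)%N -> exists K : R -> 'M[C]_N, [/\ mx_analytic_in D K,
    forall t, D t -> psdmx (A t - K t *m adjmx (K t)) /\
      forall j : 'I_N, (j < m)%N -> Re ((A t - K t *m adjmx (K t)) j j) = 0 &
    forall t (j : 'I_N), (m <= j)%N -> K t *m (delta_mx j 0 : 'cV[C]_N) = 0].
  have [K [aK HK _]] := step N (leqnn N).
  exists K => // t Dt; apply/eqP; rewrite -subr_eq0; apply/eqP.
  by have [pB dB] := HK t Dt; apply: psd_diag0 => // j; exact: dB.
elim: m => [|m IH] mN.
  exists (fun=> 0); split; first exact: mx_analytic_cst.
    by move=> t Dt; rewrite mul0mx subr0; split=> //; exact: pA.
  by move=> t j _; rewrite mul0mx.
have [K [aK HK K0]] := IH (ltnW mN).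
pose i := Ordinal mN.
have aB : mx_analytic_in D (fun t => A t - K t *m adjmx (K t)).
  by apply: mx_analyticB => //; apply: mx_analyticM => //; exact: mx_analytic_adj.
have [k ak Hk] := psd_eliminate i aB (fun t Dt => (HK t Dt).1).
exists (fun t => K t + k t *m delta_mx 0 i); split.
- by apply: mx_analyticD => //; apply: mx_analyticM => //; exact: mx_analytic_cst.
- move=> t Dt; rewrite outer_add ?K0// opprD addrA.
  have [pBk dBk] := Hk t Dt; split=> // j; rewrite ltnS leq_eqVlt => /orP[/eqP ji|jm].
    by rewrite (_ : j = i) //; apply: val_inj.
  (* An entry already eliminated stays zero: the step subtracts [|k_j|^2] from it, and the new
     remainder is still positive semidefinite. *)
  have [+ _] := psd_diag j pBk.
  rewrite addmxE oppmxE Re_add Re_opp Re_outer (HK t Dt).2// add0r oppr_ge0 => le0.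
  by apply/eqP; rewrite oppr_eq0 eq_le le0 addr_ge0// sqr_ge0.
- move=> t j mj; rewrite mulmxDl K0 ?(ltnW mj)// add0r -mulmxA mul_delta_mx_0 ?mulmx0//.
  by apply: contraTneq mj => <- /=; rewrite ltnn.
Qed.

(** As a Gram matrix, it expresses that the columns in [S] are orthonormal and the others zero. *)
Definition coord_proj N (S : {set 'I_N}) : 'M[C]_N := diag_mx (\row_j (j \in S)%:R).

Lemma coord_projT N : coord_proj (finset.setT : {set 'I_N}) = 1%:M.
Proof. by apply/matrixP => i j; rewrite !mxE inE. Qed.

Lemma coord_proj_setU1 N (S : {set 'I_N}) j : j \notin S ->
  coord_proj (j |: S) = coord_proj S + delta_mx j j.
Proof.
move=> jS; apply/matrixP => a b; rewrite !mxE !inE.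
have [->|ab] := eqVneq a b; last first.
  by rewrite !mulr0n add0r; case: eqVneq => //= <-; rewrite eq_sym (negbTE ab).
rewrite !mulr1n andbb; case: (eqVneq b j) => [->|] /=; last by rewrite addr0.
by rewrite (negbTE jS) add0r.
Qed.

Lemma coord_projM N (S T : {set 'I_N}) : S \subset T ->
  coord_proj S *m coord_proj T = coord_proj S.
Proof.
move=> /fintype.subsetP ST; rewrite mulmx_diag; congr diag_mx; apply/matrixP => a b.
by rewrite !mxE; case: (boolP (b \in S)) => [/ST ->|_]; rewrite ?mulr1 ?mul0r.
Qed.

(** One column at a time: with [P = 1 - W W^*], the normalised vector [P e_i / g], where
    [g ^+ 2 = P i i], extends analytically over the zeros of [g] and is orthogonal to the columns of
    [W]. The index [i] is picked at the single point [c] and serves all of [D], since [g] then has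
    isolated zeros. *)
Lemma unitary_completion N c : D c -> forall (S : {set 'I_N}) (W : R -> 'M[C]_N),
  mx_analytic_in D W -> (forall t, D t -> adjmx (W t) *m W t = coord_proj S) ->
  (forall t, W t *m coord_proj S = W t) ->
  exists2 U : R -> 'M[C]_N, mx_analytic_in D U &
    (forall t, D t -> adjmx (U t) *m U t = 1%:M) /\
    forall t i j, j \in S -> U t i j = W t i j.
Proof.
move=> Dc S; have [k] := ubnP #|~: S|; elim: k S => // k IH S /ltnSE Sk W aW WW WS.
have [S0|[j]] := set_0Vmem (~: S).
  have ST : S = finset.setT by rewrite -(finset.setCK S) S0 finset.setC0.
  by exists W => //; split=> // t Dt; rewrite WW// ST coord_projT.
rewrite inE => jS.
pose P t : 'M[C]_N := 1%:M - W t *m adjmx (W t).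
have aP : mx_analytic_in D P.
  apply: mx_analyticB; first exact: mx_analytic_cst.
  by apply: mx_analyticM => //; exact: mx_analytic_adj.
have adjP t : adjmx (P t) = P t.
  rewrite /P adjmxD adjmxN adjmxM adjmxK; congr (_ - _).
  by apply/matrixP => a b; rewrite !mxE eq_sym rmorph_nat.
have SW t : coord_proj S *m adjmx (W t) = adjmx (W t).
  rewrite -[in RHS](WS t) adjmxM; congr (_ *m _).
  by apply/matrixP => a b; rewrite !mxE eq_sym; case: eqVneq => [->|]; rewrite ?mulr1n ?mulr0n ?rmorph_nat ?rmorph0.
have WP t : D t -> adjmx (W t) *m P t = 0.
  by move=> Dt; rewrite /P mulmxBr mulmx1 mulmxA WW// SW subrr.
have PP t : D t -> P t *m P t = P t.
  by move=> Dt; rewrite {1}/P mulmxBl mul1mx -mulmxA WP// mulmx0 subr0.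
have pP t : D t -> psdmx (P t).
  by move=> Dt; rewrite -PP// -{1}adjP; exact: psd_gram.
(* Otherwise [P c = 0] and [W c] is unitary, although its column [j] is zero. *)
have [i Pi] : exists i, Re (P c i i) != 0.
  apply: contrapT => nex.
  have P0 : P c = 0.
    apply: psd_diag0; first exact: pP.
    by move=> i; apply/eqP; apply: contra_notT nex => ?; exists i.
  have e1 : W c *m adjmx (W c) = 1%:M by apply/esym/eqP; rewrite -subr_eq0 -/(P c) P0.
  have /matrixP/(_ j j) := mulmx1C e1; rewrite WW// !mxE (negbTE jS) eqxx mulr1n.
  by move=> /eqP; rewrite eq_sym oner_eq0.
have [g [u [ig au Pg ug]]] := psd_column_root Ditv Dopen aP pP Dc Pi.
pose G t : C := Complex (g t) 0.
have G0 t : g t != 0 -> G t != 0 by move=> gt0; rewrite eq_complex /= negb_and gt0.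
have uE t : D t -> G t *: u t = P t *m (delta_mx i 0 : 'cV[C]_N).
  by move=> Dt; rewrite -colE; apply/matrixP => a b; rewrite scalemxE ord1 mulrC ug// [RHS]mxE.
have Wu t : D t -> adjmx (W t) *m u t = 0.
  move: t; apply: (mx_analytic_eq0_off Dopen ig) => [|t Dt /G0 Gt].
    by apply: mx_analyticM => //; exact: mx_analytic_adj.
  by apply: (scalerI Gt); rewrite scalemxAr uE// mulmxA WP// mul0mx scaler0.
(* Off the zeros of [g] this is [e_i^* P P e_i = P i i = g ^+ 2], as [P] is a Hermitian
   projection. *)
have uu t : D t -> adjmx (u t) *m u t = 1%:M.
  move=> Dt; apply/eqP; rewrite -subr_eq0; apply/eqP; move: t Dt.
  apply: (mx_analytic_eq0_off Dopen ig) => [|t Dt /[dup] gt0 /G0 Gt].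
    apply: mx_analyticB; last exact: mx_analytic_cst.
    by apply: mx_analyticM => //; exact: mx_analytic_adj.
  have conjG : Num.conj (G t) = G t by apply: complex_eqP; rewrite ?Re_conj ?Im_conj //= oppr0.
  apply: (scalerI Gt); apply: (scalerI Gt); rewrite !scaler0 !scalerBr.
  rewrite scalemxAr uE// scalemxAl -{1}conjG -adjmxZ uE// adjmxM adjP.
  rewrite mulmxA -(mulmxA (adjmx _)) PP//.
  apply/eqP; rewrite subr_eq0; apply/eqP; apply/matrixP => a b.
  rewrite !ord1 form_delta !scalemxE [1%:M _ _]mxE eqxx mulr1.
  have [_ Pii] := psd_diag i (pP t Dt).
  by apply: complex_eqP; rewrite ?ReImE /= ?Pii ?Pg//; ring.
pose W' t : 'M[C]_N := W t + u t *m delta_mx 0 j.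
have [|||t|U aU [UU UW]] := IH (j |: S) _ W'.
- rewrite (leq_trans _ Sk)//; apply: proper_card.
  apply/properP; split; first by apply/fintype.subsetP => x; rewrite !inE negb_or => /andP[].
  by exists j; rewrite !inE ?eqxx.
- apply: mx_analyticD => //; apply: mx_analyticM => //; exact: mx_analytic_cst.
- move=> t Dt; rewrite /W' adjmxD adjmxM adjmx_delta mulmxDl !mulmxDr WW//.
  rewrite (mulmxA (adjmx (W t))) Wu// mul0mx addr0 -(mulmxA (delta_mx j 0)).
  rewrite -[adjmx (u t) *m W t]adjmxK adjmxM adjmxK Wu// (_ : adjmx 0 = 0); last first.
    by apply/matrixP => a b; rewrite !mxE rmorph0.
  rewrite mulmx0 add0r -mulmxA (mulmxA (adjmx (u t))) uu// mul1mx mul_delta_mx.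
  by rewrite coord_proj_setU1.
- rewrite /W' mulmxDl; congr (_ + _).
    by rewrite -{1}(WS t) -mulmxA coord_projM ?finset.subsetUr// WS.
  rewrite -mulmxA; congr (_ *m _).
  by apply/matrixP => a b; rewrite mul_mx_diag !mxE !inE; case: (eqVneq b j) => [->|]; rewrite /= ?mulr1// andbF mul0r.
exists U => //; split=> // t a b bS; rewrite UW; last by rewrite !inE bS orbT.
rewrite addmxE mxE big_ord1 mxE /= (_ : (b == j) = false) ?mulr0 ?addr0//.
by apply: contraNF jS => /eqP <-.
Qed.

End Factor.

(** * Stinespring dilation *)

Section Stinespring.
Variable R : realType.
Local Notation C := R[i].

Lemma sum_mxtens (V : nmodType) m n (F : 'I_(m * n) -> V) :
  \sum_p F p = \sum_i \sum_j F (mxtens_index (i, j)).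
Proof.
rewrite pair_big /= (reindex (@mxtens_index m n)) /=.
  by apply: eq_bigr => -[i j].
by exists (@mxtens_unindex m n) => p _; rewrite ?mxtens_indexK ?mxtens_unindexK.
Qed.

Lemma linmap_sum n (Phi : 'M[C]_n -> 'M[C]_n) : linmap Phi ->
  forall rho, Phi rho = \sum_a \sum_b rho a b *: Phi (delta_mx a b).
Proof.
move=> lin rho.
have Phi0 : Phi 0 = 0.
  by apply: (addIr (Phi 0)); have := lin 1 0 0; rewrite !scale1r addr0 add0r => <-.
have PhiD A B : Phi (A + B) = Phi A + Phi B by have := lin 1 A B; rewrite !scale1r.
have PhiZ a A : Phi (a *: A) = a *: Phi A by have := lin a A 0; rewrite Phi0 !addr0.
rewrite {1}[rho]matrix_sum_delta (big_morph Phi PhiD Phi0); apply: eq_bigr => a _.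
by rewrite (big_morph Phi PhiD Phi0); apply: eq_bigr => b _.
Qed.

Definition choi n (Phi : 'M[C]_n -> 'M[C]_n) : 'M[C]_(n * n) :=
  \matrix_(p, q) Phi (delta_mx (mxtens_unindex p).1 (mxtens_unindex q).1)
    (mxtens_unindex p).2 (mxtens_unindex q).2.

(** The Choi matrix is the amplified map applied to the rank one operator of the unnormalised
    maximally entangled vector, here the row [B]. *)
Lemma choi_psd n (Phi : 'M[C]_n -> 'M[C]_n) : completely_positive Phi -> psdmx (choi Phi).
Proof.
move=> cp; pose B : 'rV[C]_(n * n) := \row_p ((mxtens_unindex p).1 == (mxtens_unindex p).2)%:R.
suff -> : choi Phi = ampl Phi (adjmx B *m B) by apply: cp; exact: psd_gram.
apply/matrixP => p q; rewrite !mxE; congr (Phi _ _ _); apply/matrixP => i j.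
rewrite !mxE big_ord1 !mxE !mxtens_indexK /= rmorph_nat -natrM mulnb.
by rewrite [i == _]eq_sym [j == _]eq_sym.
Qed.

(** Only the columns [(a, e0)] of [U] enter: the dilation prescribes these [n] columns and leaves
    the others to the unitary completion. *)
Lemma dilation_entry n m (U : 'M[C]_(n * m)) (rho : 'M[C]_n) (e0 : 'I_m) i j :
  let w : 'cV[C]_m := delta_mx e0 0 in
  ptrace2 (U *m (rho *t (w *m adjmx w)) *m adjmx U) i j =
  \sum_a \sum_b rho a b * \sum_e U (mxtens_index (i, e)) (mxtens_index (a, e0)) *
    Num.conj (U (mxtens_index (j, e)) (mxtens_index (b, e0))).
Proof.
move=> w; rewrite mxE.
have wE x y : (w *m adjmx w) x y = ((x == e0) && (y == e0))%:R.
  by rewrite mxE big_ord1 adjmxE !mxE !andbT rmorph_nat -natrM mulnb.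
transitivity (\sum_(e < m) \sum_a \sum_b rho a b *
   (U (mxtens_index (i, e)) (mxtens_index (a, e0)) *
    Num.conj (U (mxtens_index (j, e)) (mxtens_index (b, e0))))).
  apply: eq_bigr => e _; rewrite mxE sum_mxtens.
  rewrite [RHS]exchange_big /=; apply: eq_bigr => b _.
  rewrite (bigD1 e0) //= [X in _ + X]big1 ?addr0; last first.
    move=> y ye; rewrite mxE sum_mxtens big1 ?mul0r// => a _.
    by rewrite big1// => x _; rewrite tensmxE wE (negbTE ye) andbF !mulr0.
  rewrite mxE adjmxE sum_mxtens mulr_suml; apply: eq_bigr => a _.
  rewrite (bigD1 e0) //= [X in _ + X]big1 ?addr0; last first.
    by move=> x xe; rewrite tensmxE wE (negbTE xe) !mulr0.
  by rewrite tensmxE wE eqxx mulr1 [rho a b * _]mulrCA mulrA.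
rewrite exchange_big /=; apply: eq_bigr => a _; rewrite exchange_big /=.
by apply: eq_bigr => b _; rewrite mulr_sumr.
Qed.

Lemma analytic_stinespring (D : set R) n (e0 : 'I_(n * n)) (Phi : R -> 'M[C]_n -> 'M[C]_n) :
  is_interval D -> (forall t, D t -> near0 (fun h => D (t + h))) -> D !=set0 ->
  (forall t, D t -> CPTP (Phi t)) -> curve_analytic_on D Phi ->
  exists U : R -> 'M[C]_(n * (n * n)), [/\ mx_analytic_on D U,
    forall t, D t -> Defs.unitarymx (U t) &
    forall t, D t -> forall rho, let w : 'cV[C]_(n * n) := delta_mx e0 0 in
      Phi t rho = ptrace2 (U t *m (rho *t (w *m adjmx w)) *m adjmx (U t))].
Proof.
move=> Ditv Dopen [c Dc] HPhi aPhi.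
have aC : mx_analytic_in D (fun t => choi (Phi t)).
  by move=> p q; under eq_fun do rewrite mxE; apply/(canalytic_onP Dopen); exact: aPhi.
have [|K aK HK] := psd_factor Ditv Dopen aC.
  by move=> t /HPhi[_ cp _]; exact: choi_psd.
have KE t (a b i j : 'I_n) : D t -> Phi t (delta_mx a b) i j =
    \sum_e K t (mxtens_index (a, i)) e * Num.conj (K t (mxtens_index (b, j)) e).
  move=> Dt; have /matrixP/(_ (mxtens_index (a, i)) (mxtens_index (b, j))) := HK t Dt.
  rewrite mxE !mxtens_indexK /= => ->; rewrite mxE.
  by apply: eq_bigr => e _; rewrite adjmxE.
pose S := [set q : 'I_(n * (n * n)) | (mxtens_unindex q).2 == e0]%SET.
(* The Stinespring isometry padded with zero columns: column [e] of [K], reshaped, is the Kraus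
   operator with entry [K (a, i) e] at row [i] and column [a], and [e] becomes the environment index
   of the row. *)
pose W t : 'M[C]_(n * (n * n)) := \matrix_(p, q)
  (K t (mxtens_index ((mxtens_unindex q).1, (mxtens_unindex p).1)) (mxtens_unindex p).2 *
   ((mxtens_unindex q).2 == e0)%:R).
have aW : mx_analytic_in D W.
  move=> p q; under eq_fun do rewrite mxE.
  by apply: canalyticM; [exact: aK|exact: canalytic_cst].
have WW t : D t -> adjmx (W t) *m W t = coord_proj R S.
  move=> Dt; apply/matrixP => p q.
  case: (mxtens_indexP p) => a x; case: (mxtens_indexP q) => b y.
  rewrite mxE sum_mxtens.
  under eq_bigr do under eq_bigr do rewrite adjmxE !mxE !mxtens_indexK /= rmorphM /= rmorph_nat mulrACA -natrM mulnb.
  under eq_bigr do rewrite -mulr_suml.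
  rewrite -mulr_suml.
  (* Orthonormality of the prescribed columns is trace preservation on matrix units. *)
  have -> : \sum_(i < n) \sum_(e < n * n) Num.conj (K t (mxtens_index (a, i)) e) *
      K t (mxtens_index (b, i)) e = (a == b)%:R.
    have [_ _ /(_ (delta_mx b a))] := HPhi t Dt.
    rewrite /mxtrace => e1; transitivity (\sum_i Phi t (delta_mx b a) i i).
      by apply: eq_bigr => i _; rewrite KE//; apply: eq_bigr => e _; rewrite mulrC.
    rewrite e1 (bigD1 b)//= big1 ?addr0 => [|i ib]; last by rewrite mxE (negbTE ib).
    by rewrite mxE eqxx eq_sym.
  rewrite !mxE inE mxtens_indexK /= -natrM mulnb.
  rewrite (inj_eq (can_inj (@mxtens_indexK n (n * n)))) xpair_eqE -mulrnA mulnb.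
  congr (_%:R); case: (eqVneq a b) => [_|_]; last by rewrite /= andbF.
  case: (eqVneq x y) => [->|xy]; first by rewrite /= andbb andbT.
  case: (eqVneq x e0) => //= xe; case: (eqVneq y e0) => //= ye.
  by rewrite xe ye eqxx in xy.
have WS t : W t *m coord_proj R S = W t.
  apply/matrixP => p q; rewrite mul_mx_diag !mxE inE; case: eqP => _; by rewrite ?mulr1 ?mulr0.
have [U aU [UU UW]] := unitary_completion Ditv Dopen Dc aW WW WS.
exists U; split.
- by move=> p q; apply/(canalytic_onP Dopen); exact: aU.
- by move=> t Dt; split; [apply: mulmx1C|]; exact: UU.
- move=> t Dt rho w; apply/matrixP => i j; rewrite dilation_entry.
  have [lin _ _] := HPhi t Dt; rewrite (linmap_sum lin) summxE; apply: eq_bigr => a _.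
  rewrite summxE; apply: eq_bigr => b _; rewrite scalemxE KE//; congr (_ * _).
  apply: eq_bigr => e _; rewrite !UW ?inE ?mxtens_indexK ?eqxx// !mxE !mxtens_indexK /=.
  by rewrite eqxx !mulr1.
Qed.

Lemma analytic_dilation_gt0 n (Phi : R -> 'M[C]_n -> 'M[C]_n) (D : set R) : (0 < n)%N ->
  is_interval D -> open D -> D !=set0 -> (forall t, D t -> 0 < t) ->
  (forall t, D t \/ t = 0 -> CPTP (Phi t)) -> curve_analytic_on D Phi ->
  analytic_dilation [set t | D t \/ t = 0] D Phi.
Proof.
move=> n0 Ditv oD D0 Dgt HPhi aPhi.
have Dopen t : D t -> near0 (fun h => D (t + h)).
  move=> Dt; have /nbhs_ballP[d /= d0 H] : nbhs t D by move: oD; rewrite openE; apply.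
  exists d => // h hd; apply: H; rewrite /ball /=.
  by rewrite opprD addrA subrr add0r normrN.
have nn0 : (0 < n * n)%N by rewrite muln_gt0 n0.
pose e0 := Ordinal nn0; pose w : 'cV[C]_(n * n) := delta_mx e0 0.
have [U [aU UU HU]] := analytic_stinespring e0 Ditv Dopen D0 (fun t Dt => HPhi t (or_introl Dt)) aPhi.
have [V [_ VV HV]] : exists V : R -> 'M[C]_(n * (n * n)), [/\ mx_analytic_on setT V,
    forall t, setT t -> Defs.unitarymx (V t) &
    forall t, setT t -> forall rho, let w : 'cV[C]_(n * n) := delta_mx e0 0 in
      Phi 0 rho = ptrace2 (V t *m (rho *t (w *m adjmx w)) *m adjmx (V t))].
  have oT : forall t : R, setT t -> near0 (fun h => [set: R] (t + h)) by exists 1.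
  apply: (@analytic_stinespring setT n e0 (fun=> Phi 0)) => //.
  - by exists 0.
  - by move=> t _; apply: HPhi; right.
  - by move=> i j k l; apply/(canalytic_onP oT); exact: canalytic_cst.
exists (n * n)%N; split; first by rewrite expnS expn1.
exists w, (fun t => if t == 0 then V 0 else U t); split.
- by rewrite /unit_vector adjmx_delta mul_delta_mx mxE.
- move=> t [Dt|->]; last by rewrite eqxx; exact: VV.
  by rewrite gt_eqF ?Dgt//; exact: UU.
- move=> t [Dt|->] rho; last by rewrite eqxx; exact: HV.
  by rewrite gt_eqF ?Dgt//; exact: HU.
- move=> p q; apply/(canalytic_onP Dopen).
  apply: (@canalytic_eq _ _ Dopen (fun t => U t p q)) => [t Dt|].
    by rewrite gt_eqF ?Dgt.
  by apply/(canalytic_onP Dopen); exact: aU.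
Qed.
End Stinespring.

(** * Continuous semigroups are analytic *)

Section Calculus.
Variable R : realType.

Lemma is_derive_bigsum n (f : 'I_n -> R -> R) (df : 'I_n -> R) (x : R) :
  (forall i, is_derive x 1 (f i) (df i)) ->
  is_derive x 1 (fun y => \sum_i f i y) (\sum_i df i).
Proof.
move=> H; have := is_derive_sum H; congr is_derive.
by apply/funext => y; rewrite fct_sumE.
Qed.

Lemma is_derive_scale (f : R -> R) (df k x : R) : is_derive x 1 f df ->
  is_derive x 1 (fun y => k * f y) (k * df).
Proof. exact: is_deriveZ. Qed.

Lemma is_derive_translate (f : R -> R) (df t x : R) : is_derive (t + x) 1 f df ->
  is_derive x 1 (fun y => f (t + y)) df.
Proof.
move=> H; rewrite -[df]mulr1.
apply: (@is_derive1_comp _ f (fun y => t + y)) => //.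
have -> : (fun y : R => t + y) = cst t + id by [].
by apply: is_derive_eq (is_deriveD (is_derive_cst t x 1) (is_derive_id x 1)) _; rewrite add0r.
Qed.

Lemma is_derive_bound (f df : R -> R) (a b M : R) :
  (forall x, Num.min a b <= x <= Num.max a b -> is_derive x 1 f (df x) /\ `|df x| <= M) ->
  `|f b - f a| <= M * `|b - a|.
Proof.
wlog ab : a b / a <= b.
  move=> H Hf; have [/H|/ltW /H] := leP a b; first exact.
  rewrite distrC [`|b - a|]distrC; apply.
  by rewrite minC maxC.
rewrite min_l// max_r// => H.
have Hd x : x \in `[a, b]%R -> is_derive x 1 f (df x).
  by rewrite in_itv /= => /H[].
have Hoo x : x \in `]a, b[%R -> is_derive x 1 f (df x).
  by move=> /subset_itv_oo_cc /Hd.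
have cf : {within `[a, b], continuous f}.
  by apply: derivable_within_continuous => x /Hd[].
have [c cab fE] := MVT_segment ab Hoo cf.
rewrite fE normrM ler_wpM2r//.
by move: cab; rewrite in_itv /= => /H[].
Qed.

(** The base point -1 puts 0 in the interior, so that a two-sided derivative exists there too. *)
Lemma continuous_antiderivative (f : R -> R) : continuous f ->
  exists F : R -> R, forall x : R, -1 < x -> is_derive x 1 F (f x).
Proof.
move=> cf; exists (fun x => (\int[lebesgue_measure]_(t in [set` `[-1, x]%R]) f t)%R) => x x1.
have xu : x < x + 1 by rewrite ltrDl.
have fi : lebesgue_measure.-integrable `[-1, x + 1] (EFin \o f).
  apply: continuous_compact_integrable; first exact: segment_compact.
  exact: continuous_subspaceT.
have [d1 d2] := continuous_FTC1_closed xu fi x1 (cf x).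
by split=> //; rewrite -derive1E d2.
Qed.

Lemma continuous_extend0 (f : R -> R) : {within [set t | 0 <= t], continuous f} ->
  continuous (fun t : R => f (Num.max t 0)).
Proof.
move=> /subspace_continuousP cf t.
have mA (s : R) : [set t : R | 0 <= t] (Num.max s 0) by rewrite /= le_max lexx orbT.
apply/cvgrPdist_lt => e e0.
have /cvgrPdist_lt/(_ e e0) H := cf _ (mA t).
have cm : {for t, continuous (fun s : R => Num.max s 0)}.
  by apply: continuous_max; [exact: cvg_id|exact: cvg_cst].
have {}H : nbhs (Num.max t 0) [set s | 0 <= s -> `|f (Num.max t 0) - f s| < e] := H.
suff : nbhs t [set s : R | `|f (Num.max t 0) - f (Num.max s 0)| < e] by [].
have := cm _ H; apply: (@filterS R (nbhs (t : R)) (nbhs_filter (t : R))).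
by move=> s; apply; exact: mA.
Qed.

Lemma is_derive_monomial (k : nat) (x : R) :
  is_derive x 1 (fun y : R => y ^+ k.+1 / (k.+1)`!%:R) (x ^+ k / k`!%:R).
Proof.
have := is_derive_scale (k.+1`!%:R^-1) (is_deriveX k.+1 (is_derive_id x (1 : R))).
have -> : (fun y : R => k.+1`!%:R^-1 * (id ^+ k.+1) y) = (fun y => y ^+ k.+1 / (k.+1)`!%:R).
  by apply/funext => y; rewrite mulrC exprfctE.
move=> H; apply: is_derive_eq H _; rewrite /= -[_ *: 1]/(_ * 1) mulr1.
rewrite factS natrM; field.
by rewrite nat1r !pnatr_eq0 -lt0n fact_gt0.
Qed.

(** Used for invertibility: a matrix function converging to the identity eventually has nonzero
    determinant. *)
Lemma det_cvg1 d (A : R -> 'M[R]_d) (F : set_system R) {FF : Filter F} :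
  (forall i j, (fun x => A x i j) @ F --> ((1%:M : 'M[R]_d) i j : R)) ->
  (fun x => \det (A x)) @ F --> (1 : R).
Proof.
move=> H; rewrite -[X in _ --> X](@det1 R d) /determinant.
apply: cvg_big; first exact: add_continuous.
move=> s _; apply: cvgM; first exact: cvg_cst.
by apply: cvg_big => [|i _]; [exact: mul_continuous|exact: H].
Qed.
End Calculus.

(** * Linear equations and one-parameter matrix semigroups *)

Section LinearODE.
Variable R : realType.

(** The error against the Taylor polynomial of order [N.+1] has as derivative the error of order [N]
    times [L], so the mean value theorem gains a factor [c * |h|] per order. Geometric decay
    suffices for [|h| < c^-1], so factorials need not be gained. *)
Lemma linear_ode_analytic d (G : R -> 'M[R]_d) (L : 'M[R]_d) :
  (forall t : R, 0 < t -> forall i j, is_derive t 1 (fun s => G s i j) ((G t *m L) i j)) ->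
  forall i j, ranalytic_on [set t | 0 < t] (fun t => G t i j).
Proof.
move=> HG i0 j0 t0 /= t0gt.
pose b : R := \sum_i \sum_j `|L i j|.
have Lb i j : `|L i j| <= b.
  rewrite /b (bigD1 i)//= (bigD1 j)//= -addrA lerDl addr_ge0// ?sumr_ge0// => k _.
  by rewrite sumr_ge0.
have b0 : 0 <= b by apply: sumr_ge0 => i _; apply: sumr_ge0.
(* [d%:R * b] bounds right multiplication by [L] in the entrywise norm; the summand 1 keeps [c]
   invertible. *)
pose c : R := d%:R * b + 1; have c0 : 0 < c by rewrite /c; have := mulr_ge0 (ler0n R d) b0; lra.
have [B [r [B0 r0 rt HB]]] : exists B r : R, [/\ 0 <= B, 0 < r, r <= t0 &
    forall h : R, `|h| < r -> forall i j, `|G (t0 + h) i j| <= B].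
  have cG : \forall s \near t0, forall p : 'I_d * 'I_d, `|G t0 p.1 p.2 - G s p.1 p.2| < 1.
    apply: (@filter_forall R _ (fun p : 'I_d * 'I_d => [set s | `|G t0 p.1 p.2 - G s p.1 p.2| < 1])
      (nbhs t0) (nbhs_filter t0)) => -[i j] /=.
    have [dG _] := HG t0 t0gt i j.
    have : {for t0, continuous (fun s => G s i j)}.
      by apply: differentiable_continuous; apply/derivable1_diffP.
    by move=> /cvgrPdist_lt /(_ 1 ltr01).
  have /nbhs_ballP[r /= r0 Hr] := cG.
  pose B : R := \sum_i \sum_j `|G t0 i j| + 1.
  have GB i j : `|G t0 i j| + 1 <= B.
    rewrite /B lerD2r (bigD1 i)//= (bigD1 j)//= -addrA lerDl addr_ge0// ?sumr_ge0// => k _.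
    by rewrite sumr_ge0.
  exists B, (Num.min r t0); split.
  - by rewrite /B addr_ge0// sumr_ge0// => i _; rewrite sumr_ge0.
  - by rewrite lt_min r0.
  - by rewrite ge_min lexx orbT.
  move=> h; rewrite lt_min => /andP[hr _] i j.
  have := Hr (t0 + h); rewrite /ball /= opprD addrA subrr add0r normrN => /(_ hr (i, j)) /= H.
  apply: le_trans (GB i j); rewrite (_ : G (t0 + h) i j = G t0 i j - (G t0 i j - G (t0 + h) i j)); last by ring.
  by apply: (le_trans (ler_normB _ _)); rewrite lerD2l ltW.
(* [A k] is [G t0] times the [k]-th power of [L], so [T N] truncates the series of
   [G t0 * exp (h L)]. *)
pose A k := iter k (fun X => X *m L) (G t0).
pose T N (h : R) i j : R := \sum_(k < N) A k i j * (h ^+ k / k`!%:R).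
have T0 N i j : T N.+1 0 i j = G t0 i j.
  rewrite /T big_ord_recl /= expr0 fact0 divr1 mulr1 big1 ?addr0// => k _.
  by rewrite expr0n mul0r mulr0.
have dT N (h : R) i j : is_derive h 1 (fun y => T N.+1 y i j) (\sum_k T N h i k * L k j).
  have -> : (fun y => T N.+1 y i j) =
      cst (G t0 i j) + (fun y => \sum_(k < N) A k.+1 i j * (y ^+ k.+1 / (k.+1)`!%:R)).
    by apply/funext => y; rewrite /T big_ord_recl /= expr0 fact0 divr1 mulr1.
  have -> : \sum_k T N h i k * L k j = 0 + \sum_(k < N) A k.+1 i j * (h ^+ k / k`!%:R).
    rewrite add0r /T; under eq_bigr do rewrite mulr_suml.
    rewrite exchange_big /=; apply: eq_bigr => k _.
    rewrite mxE mulr_suml; apply: eq_bigr => l _; ring.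
  apply: is_deriveD; apply: is_derive_bigsum => k.
  by apply: is_derive_scale; exact: is_derive_monomial.
have main N (h : R) : `|h| < r -> forall i j, `|G (t0 + h) i j - T N h i j| <= B * (c * `|h|) ^+ N.
  elim: N h => [|N IH] h hr i j.
    by rewrite /T big_ord0 subr0 expr0 mulr1 HB.
  pose f (y : R) := G (t0 + y) i j - T N.+1 y i j.
  have f0 : f 0 = 0 by rewrite /f T0 addr0 subrr.
  rewrite (_ : _ - _ = f h - f 0); last by rewrite f0 subr0.
  have -> : B * (c * `|h|) ^+ N.+1 = (B * (c * `|h|) ^+ N * c) * `|h - 0|.
    by rewrite subr0 exprSr; ring.
  apply: (@is_derive_bound _ f (fun y => \sum_k (G (t0 + y) i k - T N y i k) * L k j)).
  move=> x Hx.
  have xh : `|x| <= `|h|.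
    move: Hx; case: (leP 0 h) => h0 /andP[x1 x2].
      by rewrite !ger0_norm.
    by rewrite !ler0_norm ?lerN2// ltW.
  have xr := le_lt_trans xh hr.
  have tx : 0 < t0 + x by move: xr; rewrite ltr_norml => /andP[]; lra.
  split.
    have -> : \sum_k (G (t0 + x) i k - T N x i k) * L k j =
        (G (t0 + x) *m L) i j - \sum_k T N x i k * L k j.
      by rewrite mxE -sumrB; apply: eq_bigr => k _; rewrite mulrBl.
    exact: (is_deriveB (is_derive_translate (f := fun s => G s i j) (HG _ tx i j)) (dT N x i j)).
  have Bh : 0 <= B * (c * `|h|) ^+ N by rewrite mulr_ge0// exprn_ge0// mulr_ge0// ltW.
  apply: (@le_trans _ _ (\sum_(k < d) B * (c * `|h|) ^+ N * b)).
    apply: le_trans (ler_norm_sum _ _ _) _; apply: ler_sum => k _; rewrite normrM.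
    apply: ler_pM => //; apply: le_trans (IH x xr i k) _.
    apply: ler_wpM2l => //; rewrite lerXn2r ?nnegrE ?mulr_ge0 ?(ltW c0)//.
    by rewrite ler_pM2l.
  rewrite sumr_const card_ord -mulr_natr -mulrA ler_wpM2l//.
  by rewrite /c mulrC; lra.
exists (Num.min r c^-1); split; first by rewrite lt_min r0 invr_gt0.
exists (fun k => A k i0 j0 / k`!%:R) => t tgt; rewrite lt_min => /andP[tr tc].
apply: (@geometric_cvg _ _ _ B (c * `|t - t0|)).
  apply/andP; split; first by rewrite mulr_ge0// ltW.
  by rewrite mulrC -ltr_pdivlMr// div1r.
move=> N; have := main N _ tr i0 j0; rewrite subrKC.
rewrite (_ : T N _ _ _ = \sum_(k < N) A k i0 j0 / k`!%:R * (t - t0) ^+ k) //.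
by apply: eq_bigr => k _; ring.
Qed.

(** Averaging over [[t, t + x]] makes the semigroup differentiable, and the semigroup law turns this
    average into [S t] times the fixed matrix [M x], which can be inverted for a small [x]. *)
Lemma semigroup_analytic d (S : R -> 'M[R]_d) : S 0 = 1%:M ->
  (forall s t : R, 0 <= s -> 0 <= t -> S (s + t) = S s *m S t) ->
  (forall i j, {within [set t : R | 0 <= t], continuous (fun t : R => S t i j)}) ->
  forall i j, ranalytic_on [set t | 0 < t] (fun t => S t i j).
Proof.
move=> S0 SM cS.
pose S' (t : R) := S (Num.max t 0).
have S'E (t : R) : 0 <= t -> S' t = S t by move=> t0; rewrite /S' max_l.
have Fex (p : 'I_d * 'I_d) : exists F : R -> R, forall x : R, -1 < x -> is_derive x 1 F (S' x p.1 p.2).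
  exact: (continuous_antiderivative (continuous_extend0 (cS p.1 p.2))).
have [F0 HF0] := choice Fex.
pose F i j := F0 (i, j).
have HF i j (x : R) : -1 < x -> is_derive x 1 (F i j) (S' x i j) by move=> /(HF0 (i, j)).
pose M (x : R) : 'M[R]_d := \matrix_(i, j) (F i j x - F i j 0).
have SMx (t x : R) : 0 <= t -> 0 <= x -> S t *m M x = \matrix_(i, j) (F i j (t + x) - F i j t).
  move=> t0 x0; apply/matrixP => i j; rewrite !mxE.
  (* The semigroup law makes the derivative of [f] vanish, hence the bound below is taken with
     constant 0. *)
  pose f (y : R) := \sum_k S t i k * F k j y - F i j (t + y).
  suff : f x - f 0 = 0.
    rewrite /f addr0 => /eqP; rewrite subr_eq0 => /eqP e.
    under eq_bigr do rewrite mxE mulrBr.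
    rewrite sumrB; move: e; set u := \sum_(k < _) _; set v := \sum_(k < _) _; lra.
  apply/eqP; rewrite -normr_le0 -[leRHS](mul0r `|x - 0|).
  apply: (@is_derive_bound _ f (fun y => \sum_k S t i k * S' y k j - S' (t + y) i j)).
  rewrite min_l// max_r// => y /andP[y0 _]; split.
    have yt : -1 < t + y by lra.
    have y1 : -1 < y by lra.
    exact: (is_deriveB (is_derive_bigsum (fun k => is_derive_scale (S t i k) (HF k j y y1)))
      (is_derive_translate (HF i j (t + y) yt))).
  by rewrite !S'E ?addr_ge0// SM// mxE subrr normr0.
have [x x0 Mx] : exists2 x : R, 0 < x & \det (M x) != 0.
  (* [M h / h] tends to the derivative of the primitive at 0, which is [S 0 = 1]. *)
  have cd : (fun h => \det (h^-1 *: M h)) @ 0^' --> (1 : R).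
    apply: det_cvg1 => i j.
    have [] := HF i j 0 ltac:(lra).
    rewrite /derive => dF dFE.
    have : (fun h => h^-1 *: (F i j (h *: 1 + 0) - F i j 0)) @ 0^' --> S' 0 i j.
      by rewrite -dFE; exact: dF.
    rewrite S'E// S0; apply: cvg_trans; apply: near_eq_cvg; near=> h.
    by rewrite !mxE addr0 -[h *: 1]/(h * 1) mulr1.
  have : \forall h \near (0 : R)^', \det (h^-1 *: M h) != 0.
    have /cvgrPdist_lt/(_ 1 ltr01) := cd; apply: filterS => h.
    by apply: contraTneq => ->; rewrite subr0 normr1 ltxx.
  move=> [e /= e0 He].
  have e20 : 0 < e / 2 by rewrite divr_gt0.
  exists (e / 2) => //; have := He (e / 2); rewrite /ball /= sub0r normrN gtr0_norm//.
  move=> /(_ ltac:(lra)); rewrite gt_eqF// => /(_ isT).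
  by rewrite detZ mulf_eq0 negb_or => /andP[].
have Mu : M x \in unitmx by rewrite unitmxE unitfE.
pose G (t : R) : 'M[R]_d := (\matrix_(i, j) (F i j (t + x) - F i j t)) *m invmx (M x).
have GS (t : R) : 0 <= t -> G t = S t by move=> t0; rewrite /G -SMx ?(ltW x0)// mulmxK.
(* Differentiating [G] gives [(S (t + x) - S t) (M x)^-1], and [S t] factors out. *)
pose L := (S x - 1%:M) *m invmx (M x).
have HG (t : R) : 0 < t -> forall i j, is_derive t 1 (fun s => G s i j) ((G t *m L) i j).
  move=> t0 i j; have t00 := ltW t0.
  have -> : (fun s => G s i j) = (fun s => \sum_k invmx (M x) k j * (F i k (s + x) - F i k s)).
    by apply/funext => s; rewrite mxE; apply: eq_bigr => k _; rewrite mxE mulrC.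
  have -> : (G t *m L) i j = \sum_k invmx (M x) k j * (S' (x + t) i k - S' t i k).
    rewrite GS// /L mulmxA mulmxBr mulmx1 -SM ?(ltW x0)// mxE.
    apply: eq_bigr => k _; rewrite !S'E ?addr_ge0 ?(ltW x0)// mulrC [x + t]addrC.
    by congr (_ * _); rewrite !mxE.
  apply: is_derive_bigsum => k; apply: is_derive_scale.
  have xt : -1 < x + t by lra.
  have t1 : -1 < t by lra.
  have := is_deriveB (is_derive_translate (HF i k (x + t) xt)) (HF i k t t1).
  by under [X in is_derive _ _ X _ -> _]eq_fun do rewrite /= [x + _]addrC.
move=> i j t t0; have [r [r0 [a Ha]]] := linear_ode_analytic HG i j t0.
exists r; split=> //; exists a => s s0 st; rewrite -GS ?(ltW s0)//; exact: Ha.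
Unshelve. all: by end_near. Qed.
End LinearODE.

(** * Quantum dynamical semigroups as real matrix semigroups *)

Section QDSAnalytic.
Variable R : realType.
Local Notation C := R[i].
Local Notation Re := (@complex.Re R).
Local Notation Im := (@complex.Im R).

Lemma Re_sum (I : Type) (r : seq I) (P : pred I) (F : I -> C) :
  Re (\sum_(i <- r | P i) F i) = \sum_(i <- r | P i) Re (F i).
Proof. exact: (big_morph Re (@Re_add R) erefl). Qed.
Lemma Im_sum (I : Type) (r : seq I) (P : pred I) (F : I -> C) :
  Im (\sum_(i <- r | P i) F i) = \sum_(i <- r | P i) Im (F i).
Proof. exact: (big_morph Im (@Im_add R) erefl). Qed.

(** Multiplication by [A] on [C^m] seen as a real space; it is multiplicative, so the real semigroup
    result applies. *)
Definition realify m (A : 'M[C]_m) : 'M[R]_(m + m) :=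
  block_mx (map_mx Re A) (- map_mx Im A) (map_mx Im A) (map_mx Re A).

Lemma realifyM m (A B : 'M[C]_m) : realify (A *m B) = realify A *m realify B.
Proof.
rewrite /realify mulmx_block; congr block_mx; apply/matrixP => i j;
  rewrite !mxE ?Re_sum ?Im_sum -?sumrN -big_split /=; apply: eq_bigr => k _;
  rewrite !mxE ?ReImE; ring.
Qed.

Lemma realify1 m : realify (1%:M : 'M[C]_m) = 1%:M.
Proof.
rewrite scalar_mx_block /realify; congr block_mx; apply/matrixP => i j;
  by rewrite !mxE; case: (i == j); rewrite ?mulr1n ?mulr0n //= ?oppr0.
Qed.

(** Matrix of [Phi] in the basis of matrix units. It has the entries of the Choi matrix in another
    arrangement, one for which composition becomes the matrix product. *)
Definition superop n (Phi : 'M[C]_n -> 'M[C]_n) : 'M[C]_(n * n) :=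
  \matrix_(p, q) Phi (delta_mx (mxtens_unindex q).1 (mxtens_unindex q).2)
    (mxtens_unindex p).1 (mxtens_unindex p).2.

Lemma superop_comp n (Phi Psi : 'M[C]_n -> 'M[C]_n) : linmap Phi ->
  superop (Phi \o Psi) = superop Phi *m superop Psi.
Proof.
move=> lin; apply/matrixP => p q; rewrite !mxE /= (linmap_sum lin) summxE sum_mxtens.
apply: eq_bigr => a _; rewrite summxE; apply: eq_bigr => b _.
by rewrite !mxE mxtens_indexK mulrC.
Qed.

Lemma superop_id n : superop (@id 'M[C]_n) = 1%:M.
Proof.
apply/matrixP => p q; rewrite !mxE -(inj_eq (can_inj (@mxtens_unindexK n n))).
by rewrite xpair_eqE.
Qed.

Lemma QDS_analytic n (Phi : R -> 'M[C]_n -> 'M[C]_n) :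
  QDS Phi -> curve_analytic_on [set t | 0 < t] Phi.
Proof.
move=> [cptp Phi0 PhiM cPhi].
pose S t := realify (superop (Phi t)).
have cT p q : ccontinuous_on [set t : R | 0 <= t] (fun t => superop (Phi t) p q).
  rewrite (_ : (fun t => superop (Phi t) p q) = fun t =>
    Phi t (delta_mx (mxtens_unindex q).1 (mxtens_unindex q).2)
      (mxtens_unindex p).1 (mxtens_unindex p).2); first exact: cPhi.
  by apply/funext => t; rewrite mxE.
have aS := @semigroup_analytic R _ S.
have {}aS : forall i j, ranalytic_on [set t | 0 < t] (fun t => S t i j).
  apply: aS.
  - by rewrite /S Phi0 superop_id realify1.
  - move=> s t s0 t0; rewrite /S PhiM// superop_comp ?realifyM//.
    by have [] := cptp s s0.
  move=> i j; rewrite -(splitK i) -(splitK j).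
  case: (fintype.split i) (fintype.split j) => [i'|i'] [j'|j'] /=.
  - rewrite (_ : (fun t => _) = fun t => Re (superop (Phi t) i' j')); first exact: (cT _ _).1.
    by apply/funext => t; rewrite /S /realify block_mxEul mxE.
  - rewrite (_ : (fun t => _) = fun t => - Im (superop (Phi t) i' j')).
      by move=> x; apply: cvgN; exact: (cT _ _).2.
    by apply/funext => t; rewrite /S /realify block_mxEur !mxE.
  - rewrite (_ : (fun t => _) = fun t => Im (superop (Phi t) i' j')); first exact: (cT _ _).2.
    by apply/funext => t; rewrite /S /realify block_mxEdl mxE.
  - rewrite (_ : (fun t => _) = fun t => Re (superop (Phi t) i' j')); first exact: (cT _ _).1.
    by apply/funext => t; rewrite /S /realify block_mxEdr mxE.
move=> i j k l.
have TE t : Phi t (delta_mx i j) k l =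
    superop (Phi t) (mxtens_index (k, l)) (mxtens_index (i, j)).
  by rewrite mxE !mxtens_indexK.
split.
  have := aS (lshift _ (mxtens_index (k, l))) (lshift _ (mxtens_index (i, j))).
  rewrite (_ : (fun t => _) = fun t => Re (Phi t (delta_mx i j) k l))//.
  by apply/funext => t; rewrite /S /realify block_mxEul mxE -TE.
have := aS (rshift _ (mxtens_index (k, l))) (lshift _ (mxtens_index (i, j))).
rewrite (_ : (fun t => _) = fun t => Im (Phi t (delta_mx i j) k l))//.
by apply/funext => t; rewrite /S /realify block_mxEdl mxE -TE.
Qed.

End QDSAnalytic.

Theorem theorem4p2 (R : realType) (n : nat) (n_gt0 : (0 < n)%N) :
  (forall (tf : \bar R) (Phi : R -> 'M[R[i]]_n -> 'M[R[i]]_n),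
     (0 < tf)%E ->
     (forall t, 0 <= t -> (t%:E < tf)%E -> CPTP (Phi t)) ->
     curve_analytic_on [set t | 0 <= t /\ (t%:E < tf)%E] Phi ->
     analytic_dilation [set t | 0 <= t /\ (t%:E < tf)%E]
                       [set t | 0 < t /\ (t%:E < tf)%E] Phi)
  /\
  (forall Phi : R -> 'M[R[i]]_n -> 'M[R[i]]_n,
     QDS Phi -> analytic_dilation [set t | 0 <= t] [set t | 0 < t] Phi).
Proof.
split=> [tf Phi tf0 cptp aPhi|Phi qds].
  pose D := [set t : R | 0 < t /\ (t%:E < tf)%E].
  have -> : [set t : R | 0 <= t /\ (t%:E < tf)%E] = [set t | D t \/ t = 0].
    apply/seteqP; split=> t /=.
      by move=> [t0 tt]; have [->|tn0] := eqVneq t 0; [right|left; split=> //; rewrite lt_neqAle eq_sym tn0].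
    by move=> [[/ltW t0 tt]|->].
  have D0 : D !=set0.
    case: tf tf0 @D {cptp aPhi} => [r|_|//]; last by exists 1; split=> //; rewrite ltry.
    by rewrite lte_fin => r0; exists (r / 2); split; rewrite ?lte_fin; lra.
  apply: analytic_dilation_gt0 => //.
  - move=> x y [x0 _] [_ yt] z /andP[xz zy]; split; first exact: lt_le_trans xz.
    by apply: le_lt_trans yt; rewrite lee_fin.
  - apply: openI; first exact: open_gt.
    case: (tf) => [r|/=|/=].
    + rewrite (_ : (fun x : R => _) = [set t | t < r]); first exact: open_lt.
      by apply/seteqP; split=> t /=; rewrite lte_fin.
    + rewrite (_ : (fun x : R => _) = setT); first exact: openT.
      by apply/seteqP; split=> t //= _; rewrite ltry.
    + rewrite (_ : (fun x : R => _) = set0); first exact: open0.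
      by apply/seteqP; split=> t.
  - by move=> t [].
  - by move=> t [[/ltW t0 tt]|->]; apply: cptp.
  (* An expansion valid on the interval with 0 restricts to the open interval with the same radius
     and coefficients. *)
  - move=> i j k l; have [a1 a2] := aPhi i j k l.
    by split=> t [/ltW t0 tt]; [have := a1 t|have := a2 t] => -[|r [r0 [a Ha]]] //;
      exists r; split=> //; exists a => s [/ltW s0 ss]; exact: Ha.
have -> : [set t : R | 0 <= t] = [set t | [set t | 0 < t] t \/ t = 0].
  apply/seteqP; split=> t /=; last by move=> [/ltW|->].
  by have [->|tn0] := eqVneq t 0; [right|left; rewrite lt_neqAle eq_sym tn0].
apply: analytic_dilation_gt0 => //.
- by move=> x y x0 _ z /andP[xz _]; exact: lt_le_trans xz.
- by exists 1; rewrite /= ltr01.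
- by have [cptp _ _ _] := qds => t [/ltW|->]; exact: cptp.
- exact: QDS_analytic.
Qed.
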